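(* Let $(M,\alpha,J,\epsilon)$ be a contact Calabi-Yau manifold of dimension $2n+1$ and let $p\colon L\hookrightarrow M$ be an $n$-dimensional submanifold. The following facts are equivalent: 1. the submanifold satisfies $p^*(\alpha)=0$ and $p^*(\mathrm{Im}\,\epsilon)=0$; 2. there exists an orientation on $L$ making it calibrated by $\mathrm{Re}\,\epsilon$.
   Context: Contact form: a $1$-form $\alpha$ on a $(2n+1)$-dimensional manifold $M$ with $\alpha\wedge(d\alpha)^n\neq 0$ everywhere; $\xi=\ker\alpha$, $\kappa=\frac12 d\alpha$, and the Reeb vector field $R_\alpha$ is the unique vector field with $\alpha(R_\alpha)=1$, $\iota_{R_\alpha}d\alpha=0$. A complex structure $J$ on $\xi$ ($J\in\mathrm{End}(\xi)$, $J^2=-\mathrm{Id}_\xi$) is $\kappa$-calibrated if $g_J(\cdot,\cdot)=\kappa(\cdot,J\cdot)$ is a $J$-Hermitian inner product on $\xi_x$ for every $x\in M$; $J$ is extended to $TM$ by $J(R_\alpha)=0$. The pair $(\alpha,J)$ induces the Riemannian metric $g=g_J+\alpha\otimes\alpha$ on $M$. Sasakian manifold: a triple $(M,\alpha,J)$ with $\alpha$ a contact form and $J$ a $\kappa$-calibrated complex structure on $\xi$ with $N_J=-d\alpha\otimes R_\alpha$, where $N_J(X,Y)=[JX,JY]-J[X,JY]-J[Y,JX]+J^2[X,Y]$. A form $\gamma$ on $M$ is basic if $\iota_{R_\alpha}\gamma=0$ and $\mathcal{L}_{R_\alpha}\gamma=0$. Complex-valued basic $r$-forms split by type with respect to $J$,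 $\bigoplus_{p+q=r}\Lambda^{p,q}_J(\xi)$. Contact Calabi-Yau manifold: a quadruple $(M,\alpha,J,\epsilon)$ with $(M,\alpha,J)$ a $(2n+1)$-dimensional Sasakian manifold and $\epsilon\in\Lambda^{n,0}_J(\xi)$ a nowhere vanishing basic form such that $\epsilon\wedge\overline{\epsilon}=c_n\frac{\kappa^n}{n!}$ and $d\epsilon=0$, where $c_n=(-1)^{n(n+1)/2}(2i)^n$. The closed form $\mathrm{Re}\,\epsilon$ is a calibration on $(M,g)$, i.e. $\mathrm{Re}\,\epsilon|_V\leq\mathrm{Vol}(V)$ for every oriented $n$-plane $V\subset T_xM$, with $\mathrm{Vol}(V)$ computed with respect to $g$. An oriented $n$-dimensional submanifold $p\colon L\hookrightarrow M$ is calibrated by $\mathrm{Re}\,\epsilon$ if $p^*(\mathrm{Re}\,\epsilon)=\mathrm{Vol}(L)$, the Riemannian volume form of $L$ for the induced metric and orientation.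
   Formalization: In the definition of Sasakian manifold, the third term of N_J is taken as the standard -J[JX,Y] instead of the printed -J[Y,JX], with which N_J is not a tensor and N_J = -dα⊗R_α could not hold for n ≥ 1. *)

(* Defs.v *)
From HB Require Import structures.
From mathcomp Require Import all_boot all_order all_algebra all_fingroup.
From mathcomp Require Import complex.
From mathcomp Require Import all_classical all_reals all_analysis.

Set Implicit Arguments.
Unset Strict Implicit.
Unset Printing Implicit Defensive.

Import Order.TTheory GRing.Theory Num.Theory.
Import numFieldNormedType.Exports.

Local Open Scope classical_set_scope.
Local Open Scope ring_scope.
Local Open Scope complex_scope.

(* C^k on the open set U; since 'rV_m is finite dimensional, continuity of all
   the 'D_v f is continuity of the differential. *)
Fixpoint Ck (R : realType) (m : nat) (W : normedModType R) (k : nat)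
    (U : set 'rV[R]_m) (f : 'rV[R]_m -> W) : Prop :=
  match k with
  | 0 => forall y, U y -> {for y, continuous f}
  | k'.+1 => (forall y, U y -> differentiable f y) /\
             (forall v, Ck k' U (fun y => 'D_v f y))
  end.

Definition smooth_on (R : realType) (m : nat) (W : normedModType R)
    (U : set 'rV[R]_m) (f : 'rV[R]_m -> W) : Prop :=
  forall k, Ck k U f.

(* chart_map and chart_inv are total functions; only their values on chart_dom
   and on its image are meaningful. *)
Record chart (R : realType) (T : topologicalType) (m : nat) := Chart {
  chart_dom : set T;
  chart_map : T -> 'rV[R]_m;
  chart_inv : 'rV[R]_m -> T }.

Definition chart_img (R : realType) (T : topologicalType) (m : nat)
    (c : chart R T m) : set 'rV[R]_m :=
  chart_map c @` chart_dom c.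

Record is_chart (R : realType) (T : topologicalType) (m : nat)
    (c : chart R T m) : Prop := {
  chart_dom_open : open (chart_dom c);
  chart_img_open : open (chart_img c);
  chart_mapK : forall x, chart_dom c x -> chart_inv c (chart_map c x) = x;
  chart_map_cont : forall x, chart_dom c x -> {for x, continuous (chart_map c)};
  chart_inv_cont : forall y, chart_img c y -> {for y, continuous (chart_inv c)}
}.

(* A smooth m-dimensional manifold without boundary. The atlas is indexed by
   the points of the manifold, chart_at x being a chart around x; every smooth
   atlas contains a compatible one of this shape. *)
Record manifold (R : realType) (m : nat) := Manifold {
  carrier :> topologicalType;
  chart_at : carrier -> chart R carrier m;
  man_hausdorff : hausdorff_space carrier;
  man_second_countable : @second_countable carrier;
  man_chart : forall x, is_chart (chart_at x);
  man_chart_dom : forall x, chart_dom (chart_at x) x;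
  man_smooth : forall x y,
    smooth_on (chart_map (chart_at x) @`
                 (chart_dom (chart_at x) `&` chart_dom (chart_at y)))
              (chart_map (chart_at y) \o chart_inv (chart_at x)) }.

Notation dom x := (chart_dom (chart_at x)).
Notation img x := (chart_img (chart_at x)).
Notation phi x := (chart_map (chart_at x)).
Notation psi x := (chart_inv (chart_at x)).

(* The tangent space T_x M is 'rV[R]_m, a vector being given by its components
   in the chart chart_at x. If q lies in the domains of chart_at a and
   chart_at b, [chg a b q] turns the components of a vector of T_q M in
   chart_at a into its components in chart_at b. *)
Definition chg (R : realType) (m : nat) (M : manifold R m) (a b q : M)
    (v : 'rV[R]_m) : 'rV[R]_m :=
  'd (phi b \o psi a) (phi a q) v.

Definition smooth_map (R : realType) (n m : nat)
    (L : manifold R n) (M : manifold R m) (p : L -> M) : Prop :=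
  continuous p /\
  forall (u : L) (x : M),
    smooth_on (phi u @` (dom u `&` p @^-1` dom x)) (phi x \o p \o psi u).

Definition tangent_map (R : realType) (n m : nat)
    (L : manifold R n) (M : manifold R m) (p : L -> M) (u : L)
    (w : 'rV[R]_n) : 'rV[R]_m :=
  'd (phi (p u) \o p \o psi u) (phi u u) w.

Record submanifold (R : realType) (n m : nat)
    (L : manifold R n) (M : manifold R m) (p : L -> M) : Prop := {
  sub_smooth : smooth_map p;
  sub_inj : injective p;
  sub_immersion : forall u, injective (tangent_map p u) }.

Definition upd (T : Type) (k : nat) (v : 'I_k -> T) (i : 'I_k) (w : T) :
    'I_k -> T :=
  fun j => if j == i then w else v j.

Definition alternating (R : realType) (m k : nat)
    (a : ('I_k -> 'rV[R]_m) -> R) : Prop :=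
  (forall v i c u w,
     a (upd v i (c *: u + w)) = c * a (upd v i u) + a (upd v i w)) /\
  (forall v i j, i != j -> v i = v j -> a v = 0).

Definition two (T : Type) (v w : T) : 'I_2 -> T :=
  fun i => if i == ord0 then v else w.

(* With this normalisation (e1 /\ e2) (v1, v2) = e1 v1 e2 v2 - e1 v2 e2 v1. *)
Definition wedge (K : fieldType) (V : Type) (p q : nat)
    (a : ('I_p -> V) -> K) (b : ('I_q -> V) -> K) : ('I_(p + q) -> V) -> K :=
  fun v => ((p`! * q`!)%:R)^-1 *
    \sum_(s : 'S_(p + q)) (-1) ^+ s *
       a (fun i => v (s (lshift q i))) * b (fun j => v (s (rshift p j))).

Fixpoint wedge_exp (K : fieldType) (V : Type) (a : ('I_2 -> V) -> K) (k : nat) :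
    ('I_(k.*2) -> V) -> K :=
  match k with
  | 0 => fun=> 1
  | k'.+1 => wedge a (@wedge_exp K V a k')
  end.

Arguments wedge_exp {K V} a k v.

Definition cast_degree (K V : Type) (p q : nat) (e : p = q)
    (a : ('I_p -> V) -> K) : ('I_q -> V) -> K :=
  fun v => a (fun i => v (cast_ord e i)).

(* The C-multilinear extension of a to the complexification of the space,
   evaluated at the vectors X j + i Y j. *)
Definition complexified (R : realType) (m k : nat)
    (a : ('I_k -> 'rV[R]_m) -> R[i]) (X Y : 'I_k -> 'rV[R]_m) : R[i] :=
  \sum_(s : {ffun 'I_k -> bool})
     'i%C ^+ #|[set j | s j]%SET| * a (fun j => if s j then Y j else X j).

Definition vfield (R : realType) (m : nat) (M : manifold R m) :=
  M -> 'rV[R]_m.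

Definition endo (R : realType) (m : nat) (M : manifold R m) :=
  M -> 'rV[R]_m -> 'rV[R]_m.

(* K-valued k-forms, K being R or R[i]; multilinearity, alternation and
   smoothness are imposed by [is_form] and [is_cform]. *)
Definition dform (K : Type) (R : realType) (m : nat) (M : manifold R m)
    (k : nat) :=
  M -> ('I_k -> 'rV[R]_m) -> K.

Section TensorCalculus.
Context {R : realType} {m : nat} {M : manifold R m}.
Local Notation V := 'rV[R]_m.

(* Expressions in the coordinates of chart_at x. *)
Definition loc_vfield (X : vfield M) (x : M) (y : V) : V :=
  let q := psi x y in chg q x q (X q).

Definition loc_endo (J : endo M) (x : M) (y : V) (v : V) : V :=
  let q := psi x y in chg q x q (J q (chg x q q v)).

Definition loc_form (k : nat) (w : dform R M k) (x : M) (y : V)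
    (v : 'I_k -> V) : R :=
  let q := psi x y in w q (fun i => chg x q q (v i)).

Definition smooth_vfield (X : vfield M) : Prop :=
  forall x, smooth_on (img x) (loc_vfield X x).

Definition smooth_endo (J : endo M) : Prop :=
  forall x v, smooth_on (img x) (fun y => loc_endo J x y v).

Definition is_form (k : nat) (w : dform R M k) : Prop :=
  (forall x, alternating (w x)) /\
  (forall x v, smooth_on (img x) (fun y => loc_form w x y v)).

Definition bracketE (X Y : V -> V) (y : V) : V :=
  'D_(X y) Y y - 'D_(Y y) X y.

Definition bracket (X Y : vfield M) : vfield M :=
  fun x => bracketE (loc_vfield X x) (loc_vfield Y x) (phi x x).

(* Exterior derivative: the invariant formula for the constant extensions of
   the vectors v i in the chart at x, whose brackets vanish. In particular
   d a (X, Y) = X (a Y) - Y (a X) - a [X, Y] for 1-forms. *)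
Definition ext (k : nat) (w : dform R M k) : dform R M k.+1 :=
  fun x v => \sum_(i < k.+1) (-1) ^+ i *
    'D_(v i) (fun y => loc_form w x y (fun j => v (lift i j))) (phi x x).

(* Lie derivative: (L_X w) (Y_1, .., Y_k)
     = X (w (Y_1, .., Y_k)) - \sum_i w (Y_1, .., [X, Y_i], .., Y_k)
   for the constant extensions Y_i of the v i in the chart at x. *)
Definition lie (X : vfield M) (k : nat) (w : dform R M k) : dform R M k :=
  fun x v =>
    'D_(X x) (fun y => loc_form w x y v) (phi x x)
    - \sum_(i < k)
        w x (upd v i (bracketE (loc_vfield X x) (fun=> v i) (phi x x))).

(* i_X w = 0; for an alternating w all slots are equivalent. *)
Definition contraction0 (X : vfield M) (k : nat) (w : dform R M k) : Prop :=
  forall x v i, v i = X x -> w x v = 0.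

Definition basic (X : vfield M) (k : nat) (w : dform R M k) : Prop :=
  contraction0 X w /\ (forall x v, lie X w x v = 0).

Definition Re_form (k : nat) (w : dform R[i] M k) : dform R M k :=
  fun x v => complex.Re (w x v).

Definition Im_form (k : nat) (w : dform R[i] M k) : dform R M k :=
  fun x v => complex.Im (w x v).

Definition is_cform (k : nat) (w : dform R[i] M k) : Prop :=
  is_form (Re_form w) /\ is_form (Im_form w).

Definition cbasic (X : vfield M) (k : nat) (w : dform R[i] M k) : Prop :=
  basic X (Re_form w) /\ basic X (Im_form w).

Definition cclosed (k : nat) (w : dform R[i] M k) : Prop :=
  (forall x v, ext (Re_form w) x v = 0) /\
  (forall x v, ext (Im_form w) x v = 0).

End TensorCalculus.

Definition pullback (K : Type) (R : realType) (n m : nat)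
    (L : manifold R n) (M : manifold R m) (p : L -> M) (k : nat)
    (w : dform K M k) : dform K L k :=
  fun u v => w (p u) (fun i => tangent_map p u (v i)).

Definition ev1 (R : realType) (m : nat) (M : manifold R m)
    (alpha : dform R M 1) (x : M) (v : 'rV[R]_m) : R :=
  alpha x (fun=> v).

Definition xi (R : realType) (m : nat) (M : manifold R m)
    (alpha : dform R M 1) (x : M) : set 'rV[R]_m :=
  [set v | ev1 alpha x v = 0].

Definition kappa (R : realType) (m : nat) (M : manifold R m)
    (alpha : dform R M 1) : dform R M 2 :=
  fun x v => 2^-1 * ext alpha x v.

Record contact_form (R : realType) (n : nat) (M : manifold R n.*2.+1)
    (alpha : dform R M 1) : Prop := {
  contact_is_form : is_form alpha;
  contact_nondeg : forall x, exists v,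
    wedge (alpha x) (wedge_exp (ext alpha x) n) v != 0 }.

Record reeb_field (R : realType) (m : nat) (M : manifold R m)
    (alpha : dform R M 1) (Rv : vfield M) : Prop := {
  reeb_smooth : smooth_vfield Rv;
  reeb_alpha : forall x, ev1 alpha x (Rv x) = 1;
  reeb_dalpha : contraction0 Rv (ext alpha) }.

Definition g_J (R : realType) (m : nat) (M : manifold R m)
    (alpha : dform R M 1) (J : endo M) (x : M) (v w : 'rV[R]_m) : R :=
  kappa alpha x (two v (J x w)).

(* A complex structure on xi, extended to the tangent bundle by J Rv = 0. *)
Record complex_structure (R : realType) (m : nat) (M : manifold R m)
    (alpha : dform R M 1) (Rv : vfield M) (J : endo M) : Prop := {
  cs_linear : forall x, linear (J x);
  cs_smooth : smooth_endo J;
  cs_xi : forall x v, xi alpha x v -> xi alpha x (J x v);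
  cs_sqr : forall x v, xi alpha x v -> J x (J x v) = - v;
  cs_reeb : forall x, J x (Rv x) = 0 }.

Record calibrated_cs (R : realType) (m : nat) (M : manifold R m)
    (alpha : dform R M 1) (J : endo M) : Prop := {
  cal_sym : forall x v w, xi alpha x v -> xi alpha x w ->
    g_J alpha J x v w = g_J alpha J x w v;
  cal_pos : forall x v, xi alpha x v -> v != 0 -> 0 < g_J alpha J x v v;
  cal_herm : forall x v w, xi alpha x v -> xi alpha x w ->
    g_J alpha J x (J x v) (J x w) = g_J alpha J x v w }.

Definition metric (R : realType) (m : nat) (M : manifold R m)
    (alpha : dform R M 1) (J : endo M) (x : M) (v w : 'rV[R]_m) : R :=
  g_J alpha J x v w + ev1 alpha x v * ev1 alpha x w.

Definition ap_endo (R : realType) (m : nat) (M : manifold R m)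
    (J : endo M) (X : vfield M) : vfield M :=
  fun x => J x (X x).

(* The third term is - J [J X, Y], as in the usual Nijenhuis tensor; with
   - J [Y, J X] the expression would be neither skew nor tensorial. *)
Definition nijenhuis (R : realType) (m : nat) (M : manifold R m)
    (J : endo M) (X Y : vfield M) : vfield M :=
  fun x => bracket (ap_endo J X) (ap_endo J Y) x
           - J x (bracket X (ap_endo J Y) x)
           - J x (bracket (ap_endo J X) Y x)
           + J x (J x (bracket X Y x)).

Record sasakian (R : realType) (n : nat) (M : manifold R n.*2.+1)
    (alpha : dform R M 1) (Rv : vfield M) (J : endo M) : Prop := {
  sas_contact : contact_form alpha;
  sas_reeb : reeb_field alpha Rv;
  sas_J : complex_structure alpha Rv J;
  sas_calibrated : calibrated_cs alpha J;
  sas_normal : forall X Y : vfield M, smooth_vfield X -> smooth_vfield Y ->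
    forall x, nijenhuis J X Y x = - ext alpha x (two (X x) (Y x)) *: Rv x }.

(* xi^{1,0} = {X - i J X} and xi^{0,1} = {X + i J X}; a form of type (p, q)
   vanishes on p + q vectors of these spaces unless p of them are in
   xi^{1,0}. *)
Definition has_type (R : realType) (m : nat) (M : manifold R m)
    (alpha : dform R M 1) (J : endo M) (p q r : nat) (w : dform R[i] M r) :
    Prop :=
  (p + q)%N = r /\
  forall (x : M) (X : 'I_r -> 'rV[R]_m) (t : {ffun 'I_r -> bool}),
    (forall j, xi alpha x (X j)) -> #|[set j | t j]%SET| <> p ->
    complexified (w x) X (fun j => if t j then - J x (X j) else J x (X j)) = 0.

Record Lambda (R : realType) (m : nat) (M : manifold R m)
    (alpha : dform R M 1) (Rv : vfield M) (J : endo M) (p q r : nat)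
    (w : dform R[i] M r) : Prop := {
  Lambda_form : is_cform w;
  Lambda_basic : cbasic Rv w;
  Lambda_type : has_type alpha J p q w }.

Definition c_ (R : realType) (n : nat) : R[i] :=
  (-1) ^+ ((n * n.+1)./2) * (2 * 'i%C) ^+ n.

Record contact_CY (R : realType) (n : nat) (M : manifold R n.*2.+1)
    (alpha : dform R M 1) (Rv : vfield M) (J : endo M)
    (eps : dform R[i] M n) : Prop := {
  cy_sasakian : sasakian alpha Rv J;
  cy_type : Lambda alpha Rv J n 0 eps;
  cy_nonzero : forall x, exists v, eps x v != 0;
  cy_volume : forall x v,
    cast_degree (addnn n) (wedge (eps x) (fun v' => conjc (eps x v'))) v
    = c_ R n * (wedge_exp (kappa alpha x) n v / n`!%:R)%:C;
  cy_closed : cclosed eps }.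

(* [o u] is true when the coordinate frame of chart_at u at u is negatively
   oriented. The condition states that, around each u, the coordinate frame of
   chart_at u has constant orientation. *)
Definition orientation (R : realType) (n : nat) (L : manifold R n)
    (o : L -> bool) : Prop :=
  forall u : L, \forall q \near u,
    (-1) ^+ o q * Num.sg (\det (lin1_mx (chg u q q))) = (-1) ^+ o u :> R.

Definition induced_metric (R : realType) (n m : nat)
    (L : manifold R n) (M : manifold R m) (p : L -> M)
    (g : M -> 'rV[R]_m -> 'rV[R]_m -> R) (u : L) (v w : 'rV[R]_n) : R :=
  g (p u) (tangent_map p u v) (tangent_map p u w).

(* The Riemannian volume form sqrt (det (h_ij)) dx_1 /\ .. /\ dx_n in positive
   coordinates. *)
Definition volume_form (R : realType) (n : nat) (L : manifold R n)
    (o : L -> bool) (h : L -> 'rV[R]_n -> 'rV[R]_n -> R) : dform R L n :=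
  fun u v =>
    (-1) ^+ o u
    * Num.sqrt (\det (\matrix_(i < n, j < n)
                        h u (delta_mx 0 i) (delta_mx 0 j)))
    * \det (\matrix_(i < n) v i).

Definition calibrated_by (R : realType) (n m : nat)
    (L : manifold R n) (M : manifold R m) (p : L -> M)
    (g : M -> 'rV[R]_m -> 'rV[R]_m -> R) (o : L -> bool)
    (w : dform R M n) : Prop :=
  forall u v, pullback p w u v = volume_form o (induced_metric p g) u v.

(* Main.v *)
Require Import Defs.
From HB Require Import structures.
From mathcomp Require Import all_boot all_order all_algebra all_fingroup.
From mathcomp Require Import complex.
From mathcomp Require Import ring.
From mathcomp Require Import all_classical all_reals all_analysis.
Import Order.TTheory GRing.Theory Num.Theory.
Import numFieldNormedType.Exports.
Local Open Scope ring_scope.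

(* Fix a point of L and let z be a frame of its tangent space. If z lies in xi,
   is g-orthogonal and kappa vanishes on it, then evaluating the identity
   eps /\ conj eps = c_n kappa^n / n! on (z, J z) gives |eps z|^2 = prod |z_i|^2.
   As eps is of type (n, 0), it is unchanged by a complex Gram-Schmidt process,
   whence Hadamard's inequality |eps z|^2 <= prod |z_i|^2 for every frame of xi.

   (1) => (2): differentiating p^* alpha = 0 shows that kappa vanishes on L, so
   |eps z|^2 is the Gram determinant; Im eps = 0 then makes Re eps equal to
   plus or minus the volume form, and its sign is the required orientation.

   (2) => (1): for a g-orthogonal frame z with components z' in xi one has
   prod (|z'_i|^2 + alpha(z_i)^2) = (Re eps z)^2 <= |eps z'|^2 <= prod |z'_i|^2,
   which forces alpha(z_i) = 0 and Im eps z = 0. *)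

Local Notation alternating := Defs.alternating.

Set Implicit Arguments.
Unset Strict Implicit.
Unset Printing Implicit Defensive.

(** * Alternating forms *)

(** The volume identity is a sum over permutations of ['I_(n + n)], so both of its sides are
    transported to that index set: along a frame a form becomes a function of index maps, a wedge
    product becomes the antisymmetrization of a tensor product, and the values are found through
    determinants. The signs coming from the order of the frame and from [c_] are never computed: the
    two sides are compared after squaring, and nonnegativity recovers the equality.

    The type condition only says that [eps] vanishes on certain families of vectors X + i J X and X
    - i J X; a finite Fourier inversion over the choices of sign turns it into complex linearity.

    A further obstacle is that tangent vectors at [q] are written in the chart [chart_at q], which
    may jump with [q]. Whatever compares nearby points, namely the vanishing of kappa on L and the
    local constancy of the orientation, is moved to fixed charts; the former then rests on the
    symmetry of second derivatives. *)

Lemma updE T k (v : 'I_k -> T) i w : upd v i w i = w.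
Proof. by rewrite /upd eqxx. Qed.

Lemma updN T k (v : 'I_k -> T) i w j : j != i -> upd v i w j = v j.
Proof. by rewrite /upd => /negPf ->. Qed.

Lemma upd_id T k (v : 'I_k -> T) i : upd v i (v i) = v.
Proof. by apply/funext => j; rewrite /upd; case: eqP => // ->. Qed.

Lemma updC T k (v : 'I_k -> T) i j u w :
  i != j -> upd (upd v i u) j w = upd (upd v j w) i u.
Proof.
move=> ij; apply/funext => l; rewrite /upd; case: (eqVneq l j) => // ->.
by rewrite eq_sym (negPf ij).
Qed.

Section Alternating.
Context {R : realType} {m k : nat}.
Implicit Types (a : ('I_k -> 'rV[R]_m) -> R) (v : 'I_k -> 'rV[R]_m).

Lemma altD a v i u w : alternating a ->
  a (upd v i (u + w)) = a (upd v i u) + a (upd v i w).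
Proof. by case=> aL _; rewrite -[u]scale1r aL mul1r scale1r. Qed.

Lemma alt0 a v i : alternating a -> a (upd v i 0) = 0.
Proof.
move=> aA; apply: (addrI (a (upd v i 0))).
by rewrite -altD // !addr0.
Qed.

Lemma altZ a v i c w : alternating a -> a (upd v i (c *: w)) = c * a (upd v i w).
Proof.
by move=> aA; have [aL _] := aA; rewrite -[c *: w]addr0 aL alt0 // addr0.
Qed.

Lemma alt_sum a v i (I : Type) (r : seq I) (P : pred I) (w : I -> 'rV[R]_m) :
  alternating a ->
  a (upd v i (\sum_(j <- r | P j) w j)) = \sum_(j <- r | P j) a (upd v i (w j)).
Proof.
move=> aA; elim/big_rec2: _ => [|j x y _ <-]; first exact: alt0.
exact: altD.
Qed.

Lemma alt_tperm a v i j : alternating a -> i != j ->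
  a (v \o tperm i j) = - a v.
Proof.
move=> aA ij; have [_ a0] := aA; have ji : j != i by rewrite eq_sym.
pose F x y := a (upd (upd v i x) j y).
have F0 x : F x x = 0.
  by apply: (a0 _ i j) => //; rewrite updE (updN _ _ ij) updE.
have FDr x y z : F x (y + z) = F x y + F x z by exact: altD.
have FDl x y z : F (x + y) z = F x z + F y z.
  by rewrite /F !(updC _ _ _ ij) altD.
have -> : a (v \o tperm i j) = F (v j) (v i).
  congr a; apply/funext => l; rewrite /= /upd; case: tpermP => [->|->|].
  - by rewrite (negPf ij) eqxx.
  - by rewrite eqxx.
  - by move/eqP/negPf => -> /eqP/negPf ->.
have -> : a v = F (v i) (v j) by rewrite /F !upd_id.
have := F0 (v i + v j); rewrite FDr !FDl !F0 add0r addr0 => /eqP.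
by rewrite addr_eq0 => /eqP.
Qed.

Lemma alt_perm a v (s : 'S_k) : alternating a -> a (v \o s) = (-1) ^+ s * a v.
Proof.
move=> aA; have [ts -> tsP] := prod_tpermP s.
elim: ts tsP v => [_|[i j] ts IH /= /andP[ij tsP]] v.
  rewrite big_nil odd_perm1 mul1r; congr a.
  by apply/funext => l /=; rewrite perm1.
rewrite big_cons.
have -> : v \o (tperm i j * \prod_(t <- ts) tperm t.1 t.2)%g =
          (v \o (\prod_(t <- ts) tperm t.1 t.2)%g) \o tperm i j.
  by apply/funext => l /=; rewrite permM.
rewrite alt_tperm //= IH // odd_permM odd_tperm ij /=.
by rewrite signrN mulNr.
Qed.

End Alternating.

Lemma det_alternating {R : realType} {n : nat} :
  alternating (fun v : 'I_n -> 'rV[R]_n => \det (\matrix_i v i)).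
Proof.
split=> [v i c u w|v i j ij vij].
  rewrite -[X in _ = _ + X]mul1r; apply: (determinant_multilinear (i0 := i)).
  - by apply/rowP => l; rewrite !mxE !updE !mxE mul1r.
  - by apply/matrixP => s t; rewrite !mxE !updN // eq_sym neq_lift.
  - by apply/matrixP => s t; rewrite !mxE !updN // eq_sym neq_lift.
by apply: (determinant_alternate ij) => l; rewrite !mxE vij.
Qed.

Section TopDegree.
Context {R : realType} {m n : nat}.
Variable a : ('I_n -> 'rV[R]_m) -> R.
Hypothesis aA : alternating a.

(** The case of [alt_det] where every row is a basis vector: a repeated index kills both sides, and
    otherwise [f] is a permutation whose sign is the determinant. *)
Lemma alt_reindex (b : 'I_n -> 'rV[R]_m) (f : 'I_n -> 'I_n) :
  a (b \o f) = \det (\matrix_i (delta_mx 0 (f i) : 'rV[R]_n)) * a b.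
Proof.
have [fI|/injectivePn[i [j ij fij]]] := boolP (injectiveb f); last first.
  case: (aA) => _ a0; rewrite (a0 _ i j ij) /= ?fij //.
  case: (@det_alternating R n) => _ d0.
  by rewrite (d0 _ i j ij) ?fij // mul0r.
pose s := perm (injectiveP _ fI).
have -> : b \o f = b \o s by apply/funext => i /=; rewrite permE.
rewrite alt_perm //; congr (_ * _); rewrite -(det_perm R s); congr (\det _).
by apply/matrixP => i j; rewrite !mxE permE eqxx [j == _]eq_sym.
Qed.

Lemma alt_det (A : 'M[R]_n) (b : 'I_n -> 'rV[R]_m) :
  a (fun i => \sum_j A i j *: b j) = \det A * a b.
Proof.
pose v l (f : 'I_n -> 'I_n) (i : 'I_n) :=
  if (i < l)%N then \sum_j A i j *: b j else b (f i).
pose d l (f : 'I_n -> 'I_n) (i : 'I_n) : 'rV[R]_n :=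
  if (i < l)%N then row i A else delta_mx 0 (f i).
suff H l f : (l <= n)%N -> a (v l f) = \det (\matrix_i d l f i) * a b.
  have := H n id (leqnn n).
  have -> : v n id = (fun i => \sum_j A i j *: b j).
    by apply/funext => i; rewrite /v ltn_ord.
  move=> ->; congr (\det _ * _).
  by apply/row_matrixP => i; rewrite rowK /d ltn_ord.
elim: l f => [|l IH] f ln.
  by rewrite -[v 0%N f]/(b \o f) alt_reindex.
pose i0 := Ordinal ln.
have fu (i : 'I_n) : i != i0 -> (i < l.+1)%N = (i < l)%N.
  by move=> /eqP ii0; rewrite ltnS leq_eqVlt; case: eqP => // e;
    case: ii0; apply/val_inj.
have -> : v l.+1 f = upd (v l f) i0 (\sum_j A i0 j *: b j).
  apply/funext => i; rewrite /v /upd; case: eqP => [->|/eqP ii0].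
    by rewrite /= ltnSn.
  by rewrite fu.
have -> : d l.+1 f = upd (d l f) i0 (\sum_j A i0 j *: delta_mx 0 j).
  apply/funext => i; rewrite /d /upd; case: eqP => [->|/eqP ii0].
    by rewrite /= ltnSn [LHS]row_sum_delta; apply: eq_bigr => j _; rewrite mxE.
  by rewrite fu.
rewrite alt_sum // (alt_sum _ _ _ _ _ det_alternating) mulr_suml.
apply: eq_bigr => j _; rewrite altZ // (altZ _ _ _ _ (@det_alternating R n)) -mulrA.
congr (_ * _).
have := IH (upd f i0 j) (ltnW ln).
have -> : v l (upd f i0 j) = upd (v l f) i0 (b j).
  apply/funext => i; rewrite /v /upd; case: eqP => [->|/eqP ii0] //.
  by rewrite /= ltnn.
have -> : d l (upd f i0 j) = upd (d l f) i0 (delta_mx 0 j).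
  apply/funext => i; rewrite /d /upd; case: eqP => [->|/eqP ii0] //.
  by rewrite /= ltnn.
by [].
Qed.

End TopDegree.

(** * Wedge products as antisymmetrizations *)

(** The block permutation given by [s] on the first p indices and by [t] on the last q: the
    embedding of S_p x S_q into S_(p+q). *)
Definition perm_sum_fun p q (s : 'S_p) (t : 'S_q) (i : 'I_(p + q)) :
    'I_(p + q) :=
  match fintype.split i with
  | inl a => lshift q (s a)
  | inr b => rshift p (t b)
  end.

Lemma perm_sum_fun_inj p q (s : 'S_p) (t : 'S_q) : injective (perm_sum_fun s t).
Proof.
move=> i j; rewrite /perm_sum_fun.
case: (split_ordP i) => i' ->; case: (split_ordP j) => j' -> /eqP.
- by rewrite eq_shift => /eqP/perm_inj ->.
- by rewrite eq_shift.
- by rewrite eq_shift.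
- by rewrite eq_shift => /eqP/perm_inj ->.
Qed.

Definition perm_sum p q (s : 'S_p) (t : 'S_q) : 'S_(p + q) :=
  perm (@perm_sum_fun_inj p q s t).

Lemma perm_sum_l p q (s : 'S_p) (t : 'S_q) i :
  perm_sum s t (lshift q i) = lshift q (s i).
Proof. by rewrite permE /perm_sum_fun (unsplitK (inl _)). Qed.

Lemma perm_sum_r p q (s : 'S_p) (t : 'S_q) i :
  perm_sum s t (rshift p i) = rshift p (t i).
Proof. by rewrite permE /perm_sum_fun (unsplitK (inr _)). Qed.

Lemma sign_perm_sum (K : comNzRingType) p q (s : 'S_p) (t : 'S_q) :
  (-1) ^+ perm_sum s t = (-1) ^+ s * (-1) ^+ t :> K.
Proof.
rewrite -!det_perm -(det_ublock _ 0); congr (\det _).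
apply/matrixP => i j; rewrite !mxE.
case: (split_ordP i) => i' ->; rewrite ?perm_sum_l ?perm_sum_r mxE;
  by case: (split_ordP j) => j' ->; rewrite !mxE eq_shift.
Qed.

Section Skew.
Context {K : numFieldType} {V : Type}.

(** Left without a factor 1/p!, so that [wedge], with its own normalisation, takes two
    antisymmetrizations to that of the tensor product. *)
Definition antisym p (a : ('I_p -> V) -> K) (v : 'I_p -> V) : K :=
  \sum_(s : 'S_p) (-1) ^+ s * a (v \o s).

(** Expanding both factors gives p! q! sums over S_(p+q), one for each pair of permutations.
    Translation by the block permutation turns each of them into the same sum, and their number
    cancels the normalisation of [wedge]. *)
Lemma wedge_antisym p q (a : ('I_p -> V) -> K) (b : ('I_q -> V) -> K) v :
  wedge (antisym a) (antisym b) v =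
  antisym (fun w => a (w \o lshift q) * b (w \o @rshift p q)) v.
Proof.
pose G (s : 'S_(p + q)) : K :=
  (-1) ^+ s * (a (v \o s \o lshift q) * b (v \o s \o @rshift p q)).
transitivity ((p`! * q`!)%:R ^-1 *
    (\sum_(t : 'S_p) \sum_(u : 'S_q) \sum_s G (perm_sum t u * s)%g)).
  congr (_ * _); rewrite /antisym.
  under eq_bigr => s _ do rewrite -mulrA mulr_suml mulr_sumr.
  rewrite exchange_big; apply: eq_bigr => t _ /=.
  under eq_bigr => s _ do rewrite mulrA mulr_sumr.
  rewrite exchange_big; apply: eq_bigr => u _ /=.
  apply: eq_bigr => s _; rewrite /G odd_permM signr_addb sign_perm_sum.
  have -> : v \o (perm_sum t u * s)%g \o lshift q = v \o (s \o lshift q) \o t.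
    by apply/funext => i /=; rewrite permM perm_sum_l.
  have -> : v \o (perm_sum t u * s)%g \o @rshift p q =
            v \o (s \o @rshift p q) \o u.
    by apply/funext => i /=; rewrite permM perm_sum_r.
  move: (a _) (b _) ((-1) ^+ s) ((-1) ^+ t) ((-1) ^+ u) => A B x y z; ring.
have GE t u : \sum_s G (perm_sum t u * s)%g = \sum_s G s.
  by rewrite [RHS](reindex_inj (mulgI (perm_sum t u))).
under eq_bigr => t _ do under eq_bigr => u _ do rewrite GE.
rewrite !sumr_const -!mulrnA !card_Sn.
rewrite -[_ *+ (q`! * _)]mulr_natl [(q`! * _)%N]mulnC.
by rewrite mulKf // pnatr_eq0 -lt0n muln_gt0 !fact_gt0.
Qed.

Lemma antisym_cast p q (e : p = q) (a : ('I_p -> V) -> K) (v : 'I_q -> V) :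
  antisym a (v \o cast_ord e) = antisym (fun w => a (w \o cast_ord e)) v.
Proof.
case: q / e v => v; rewrite /antisym.
have cK (w : 'I_p -> V) : w \o cast_ord (erefl p) = w.
  by apply/funext => i /=; rewrite cast_ord_id.
by rewrite cK; apply: eq_bigr => s _; rewrite cK.
Qed.

(** The plain tensor power of [a], before antisymmetrization. *)
Fixpoint antisym_exp (a : ('I_2 -> V) -> K) k : ('I_(k.*2) -> V) -> K :=
  match k return ('I_(k.*2) -> V) -> K with
  | 0 => fun=> 1
  | k'.+1 => fun v : 'I_(2 + k'.*2) -> V =>
      a (v \o lshift k'.*2) * @antisym_exp a k' (v \o @rshift 2 k'.*2)
  end.

Lemma wedge_exp_antisym a k v :
  wedge_exp (antisym a) k v = antisym (@antisym_exp a k) v.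
Proof.
elim: k v => [|k IH] v.
  rewrite -[LHS](det_mx00 (0 : 'M[K]_0)) /determinant /antisym.
  by apply: eq_bigr => s _; rewrite big_ord0.
transitivity (wedge (antisym a) (antisym (@antisym_exp a k)) v).
  by rewrite /=; congr wedge; exact/funext.
exact: wedge_antisym.
Qed.

End Skew.

Lemma wedge_exp_comp (K : fieldType) (V W : Type) (a : ('I_2 -> W) -> K)
    (h : V -> W) k v :
  wedge_exp a k (h \o v) = wedge_exp (fun u => a (h \o u)) k v.
Proof.
elim: k v => //= k IH v; rewrite /wedge; congr (_ * _).
by apply: eq_bigr => s _; congr (_ * _); rewrite -IH.
Qed.

Lemma det_mx2 (K : comNzRingType) (A : 'M[K]_2) :
  \det A = A ord0 ord0 * A ord_max ord_max - A ord0 ord_max * A ord_max ord0.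
Proof.
have e1 : lift ord0 ord0 = ord_max :> 'I_2 by exact/val_inj.
have e2 : lift ord_max ord0 = ord0 :> 'I_2 by exact/val_inj.
rewrite (expand_det_row A ord0) !big_ord_recl big_ord0 addr0 !e1 /cofactor.
by rewrite !det_mx11 !mxE !e1 e2 /= expr0 expr1 mul1r mulN1r mulrN.
Qed.

Section PairExp.
Context {K : numFieldType} {n : nat} (g : 'I_n -> K).
Local Notation idx := 'I_(n + n).

(** With e^j and f^j the indicators of the j-th left and right index, the antisymmetrization of this
    is the sum of the g_j e^j /\ f^j, a diagonal normal form for an alternating 2-form. *)
Definition pair_form (u : 'I_2 -> idx) : K :=
  \sum_j g j * (u ord0 == lshift n j)%:R * (u ord_max == rshift n j)%:R.

Lemma antisym_pair_form (u : 'I_2 -> idx) : antisym pair_form u =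
  \sum_j g j * ((u ord0 == lshift n j)%:R * (u ord_max == rshift n j)%:R
              - (u ord_max == lshift n j)%:R * (u ord0 == rshift n j)%:R).
Proof.
rewrite /antisym /pair_form; under eq_bigr do rewrite mulr_sumr.
rewrite exchange_big; apply: eq_bigr => j _ /=.
pose M : 'M[K]_2 := \matrix_(r, c)
  if r == ord0 then (u c == lshift n j)%:R else (u c == rshift n j)%:R.
transitivity (g j * \det M); last by rewrite det_mx2 !mxE.
rewrite /determinant mulr_sumr; apply: eq_bigr => s _.
have -> : \prod_i M i (s i) =
    (u (s ord0) == lshift n j)%:R * (u (s ord_max) == rshift n j)%:R.
  rewrite !big_ord_recl big_ord0 mulr1 !mxE.
  by have -> : lift ord0 ord0 = ord_max :> 'I_2 by exact/val_inj.
by rewrite /= !mulrA [g j * _]mulrC.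
Qed.

Lemma even_ord_subproof k (i : 'I_k) : (i.*2 < k.*2)%N.
Proof. by rewrite ltn_double. Qed.
Lemma odd_ord_subproof k (i : 'I_k) : (i.*2.+1 < k.*2)%N.
Proof. by rewrite ltn_Sdouble. Qed.
Definition even_ord k (i : 'I_k) : 'I_(k.*2) := Ordinal (even_ord_subproof i).
Definition odd_ord k (i : 'I_k) : 'I_(k.*2) := Ordinal (odd_ord_subproof i).

Lemma antisym_expE V (a : ('I_2 -> V) -> K) k v :
  @antisym_exp K V a k v =
  \prod_(i < k) a (two (v (even_ord i)) (v (odd_ord i))).
Proof.
elim: k v => [|k IH] v; first by rewrite big_ord0.
rewrite big_ord_recl /= IH; congr (a _ * _).
  apply/funext => i; rewrite /two /=.
  have [->|] := eqVneq i ord0; first by congr v; apply/val_inj.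
  by case: i => [[|[|//]]] ? // _; congr v; apply/val_inj.
apply: eq_bigr => i _; congr (a _); apply/funext => j; rewrite /two.
by case: ifP => _; congr v; apply/val_inj; rewrite /= /bump /= add1n doubleS.
Qed.

(** [wedge_exp] pairs consecutive slots, while a frame (y, J y) lists all left vectors before the
    right ones. This shuffle sends the i-th left index to 2i and the i-th right one to 2i + 1. Its
    sign is kept as a symbol, since only its square will matter. *)
Definition interleave_fun (x : idx) : idx :=
  match fintype.split x with
  | inl i => cast_ord (esym (addnn n)) (even_ord i)
  | inr i => cast_ord (esym (addnn n)) (odd_ord i)
  end.

Lemma interleave_fun_inj : injective interleave_fun.
Proof.
move=> x y; rewrite /interleave_fun.
case: (split_ordP x) => i ->; case: (split_ordP y) => j -> /(congr1 val) /= e.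
- by congr lshift; apply/val_inj/double_inj.
- by have := congr1 odd e; rewrite /= !odd_double.
- by have := congr1 odd e; rewrite /= !odd_double.
- by congr rshift; apply/val_inj/double_inj; case: e.
Qed.

Definition interleave : 'S_(n + n) := perm interleave_fun_inj.

Lemma interleave_l i :
  interleave (lshift n i) = cast_ord (esym (addnn n)) (even_ord i).
Proof. by rewrite permE /interleave_fun (unsplitK (inl _)). Qed.

Lemma interleave_r i :
  interleave (rshift n i) = cast_ord (esym (addnn n)) (odd_ord i).
Proof. by rewrite permE /interleave_fun (unsplitK (inr _)). Qed.

(** Distributing the product over the sums gives one term for each map [f]. Up to the sign of
    [interleave] and the product of the [g (f i)], this term is the determinant of two diagonal
    copies of the 0-1 matrix of [f]: it is 1 if [f] is injective and 0 otherwise, and there are n!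
    injective maps. *)
Lemma antisym_exp_pair_form :
  antisym (fun w : idx -> idx =>
          antisym_exp pair_form (w \o cast_ord (esym (addnn n)))) id =
  (-1) ^+ interleave * n`!%:R * \prod_i g i.
Proof.
pose P (f : {ffun 'I_n -> 'I_n}) : 'M[K]_n := \matrix_(i, j) (j == f i)%:R.
transitivity (\sum_(f : {ffun 'I_n -> 'I_n})
   (-1) ^+ interleave * (\prod_i g (f i)) * \det (block_mx (P f) 0 0 (P f))).
  rewrite /antisym.
  under eq_bigr => s _.
    rewrite antisym_expE /pair_form /= /two /= bigA_distr_bigA mulr_sumr.
    over.
  rewrite exchange_big; apply: eq_bigr => f _ /=.
  rewrite -mulrA /determinant !mulr_sumr [RHS](reindex_inj (mulgI interleave)).
  apply: eq_bigr => s _ /=.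
  rewrite odd_permM signr_addb big_split_ord /=.
  have El i : block_mx (P f) 0 0 (P f) (lshift n i)
      ((interleave * s)%g (lshift n i)) =
      (s (cast_ord (esym (addnn n)) (even_ord i)) == lshift n (f i))%:R.
    rewrite permM interleave_l; move: (s _) => z; case: (split_ordP z) => j ->.
      by rewrite block_mxEul mxE eq_shift.
    by rewrite block_mxEur mxE eq_shift.
  have Er i : block_mx (P f) 0 0 (P f) (rshift n i)
      ((interleave * s)%g (rshift n i)) =
      (s (cast_ord (esym (addnn n)) (odd_ord i)) == rshift n (f i))%:R.
    rewrite permM interleave_r; move: (s _) => z; case: (split_ordP z) => j ->.
      by rewrite block_mxEdl mxE eq_shift.
    by rewrite block_mxEdr mxE eq_shift.
  rewrite (eq_bigr _ (fun i _ => El i)) (eq_bigr _ (fun i _ => Er i)).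
  have ee : (-1) ^+ interleave * (-1) ^+ interleave = 1 :> K.
    by rewrite -signr_addb addbb.
  rewrite !big_split /=; move: ee.
  move: ((-1) ^+ interleave) ((-1) ^+ s) (\prod_i g _) => x y z ee.
  move: (\prod_i _) (\prod_i _) => A B.
  by rewrite -[LHS]mul1r -ee; ring.
have detP f : \det (block_mx (P f) 0 0 (P f)) = (injectiveb f)%:R.
  rewrite (det_ublock (P f) 0 (P f)).
  have [fI|/injectivePn[i [j ij fij]]] := boolP (injectiveb f); last first.
    rewrite (determinant_alternate ij) ?mul0r // => l.
    by rewrite !mxE fij.
  have -> : P f = perm_mx (perm (injectiveP _ fI)).
    by apply/matrixP => i j; rewrite !mxE permE eq_sym.
  by rewrite det_perm -expr2 sqrr_sign.
rewrite (eq_bigr (fun f : {ffun 'I_n -> 'I_n} =>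
  (-1) ^+ interleave * (\prod_i g (f i)) * (injectiveb f)%:R)); last first.
  by move=> f _; congr (_ * _); exact: detP.
rewrite (bigID (fun f : {ffun 'I_n -> 'I_n} => injectiveb f)) /=.
rewrite addrC big1 ?add0r; last first.
  by move=> f /negPf ->; rewrite mulr0.
rewrite (eq_bigr (fun=> (-1) ^+ interleave * \prod_i g i)); last first.
  move=> f fI; rewrite fI mulr1; congr (_ * _).
  by rewrite [RHS](reindex_inj (injectiveP _ fI)).
have -> : n`! = #|[set f : {ffun 'I_n -> 'I_n} | injectiveb f]|.
  by rewrite card_inj_ffuns card_ord ffactnn.
rewrite sumr_const -[LHS]mulr_natr mulrAC; congr (_ * _%:R * _).
by apply: eq_card => f; rewrite inE.
Qed.

(** The hypotheses say that [a], read along [W], is the antisymmetrization of [pair_form]. *)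
Lemma wedge_exp_pairs (V : Type) (a : ('I_2 -> V) -> K) (W : idx -> V) :
  (forall i j, a (two (W (lshift n i)) (W (lshift n j))) = 0) ->
  (forall i j, a (two (W (rshift n i)) (W (rshift n j))) = 0) ->
  (forall i j, a (two (W (lshift n i)) (W (rshift n j))) = g i *+ (i == j)) ->
  (forall i j, a (two (W (rshift n i)) (W (lshift n j))) = - g i *+ (i == j)) ->
  wedge_exp a n (W \o cast_ord (esym (addnn n))) =
    (-1) ^+ interleave * n`!%:R * \prod_i g i.
Proof.
move=> all arr alr arl; rewrite wedge_exp_comp.
have -> : (fun u : 'I_2 -> idx => a (W \o u)) = antisym pair_form.
  apply/funext => u; rewrite antisym_pair_form.
  have -> : W \o u = two (W (u ord0)) (W (u ord_max)).
    apply/funext => i; rewrite /two /=; have [->//|] := eqVneq i ord0.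
    by case: i => [[|[|//]]] ? // _; congr (W (u _)); apply/val_inj.
  move: (u ord0) (u ord_max) => x y.
  case: (split_ordP x) => i ->; case: (split_ordP y) => j ->.
  - rewrite all big1 // => l _.
    by rewrite !eq_shift !(mulr0, mul0r, subr0).
  - rewrite alr (bigD1 i) //= big1 ?addr0; last first.
      by move=> l /negPf li; rewrite !eq_shift [i == l]eq_sym li !(mulr0, mul0r, subr0).
    by rewrite !eq_shift eqxx !(mulr0, mul0r, subr0, mul1r) mulr_natr eq_sym.
  - rewrite arl (bigD1 i) //= big1 ?addr0; last first.
      by move=> l /negPf li; rewrite !eq_shift [i == l]eq_sym li !(mulr0, mul0r, subr0).
    rewrite !eq_shift eqxx !(mulr0, mul0r, sub0r, mulr1).
    by rewrite mulrN mulr_natr mulNrn eq_sym.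
  - rewrite arr big1 // => l _.
    by rewrite !eq_shift !(mulr0, mul0r, subr0).
rewrite -antisym_exp_pair_form -antisym_cast -wedge_exp_antisym.
by [].
Qed.

End PairExp.

(** * Forms of type (n, 0) *)

(** [E] is the Walsh transform of [F], with characters [w]. By hypothesis [E t] vanishes unless [t]
    is constantly true, so the inversion formula [inv] makes [F] a multiple of a single
    character. *)
Lemma walsh_top {K : numFieldType} {n : nat} (F : {ffun 'I_n -> bool} -> K) :
  (forall t : {ffun 'I_n -> bool}, #|[set j | t j]%SET| <> n ->
    \sum_(s : {ffun _}) (\prod_j (if s j && t j then -1 else 1)) * F s = 0) ->
  forall s, F s = (\prod_j (if s j then -1 else 1)) * F [ffun=> false].
Proof.
move=> F0 s.
pose w (s t : {ffun 'I_n -> bool}) : K := \prod_j (if s j && t j then -1 else 1).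
pose E t := \sum_s w s t * F s.
have inv s' : \sum_t w s' t * E t = 2 ^+ n * F s'.
  rewrite /E; under eq_bigr do rewrite mulr_sumr.
  rewrite exchange_big /=.
  have ws u : \sum_t w s' t * w u t = 2 ^+ n *+ (u == s').
    under eq_bigr do rewrite -big_split /=.
    rewrite -(bigA_distr_bigA (fun j b => (if s' j && b then -1 else 1) *
      (if u j && b then -1 else 1))) /=.
    under eq_bigr => j _.
      rewrite big_bool /= !andbT !andbF mulr1.
      rewrite (_ : _ + _ = 2 *+ (u j == s' j)); last first.
        by case: (s' j); case: (u j); rewrite /= ?mulrNN ?mulr1 ?mul1r ?addNr.
      over.
    have [->|/eqP us] := eqVneq u s'.
      by under eq_bigr do rewrite eqxx; rewrite prodr_const card_ord.
    case: (pickP (fun j => u j != s' j)) => [j ne|e].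
      by rewrite (bigD1 j) //= (negPf ne) mulr0n mul0r.
    by case: us; apply/ffunP => j; have := e j; case: eqP.
  under eq_bigr => u _ do (under eq_bigr do rewrite mulrA; rewrite -mulr_suml ws).
  rewrite (bigD1 s') //= eqxx big1 ?addr0 // => u /negPf ->.
  by rewrite mulr0n mul0r.
have top s' : \sum_t w s' t * E t = w s' [ffun=> true] * E [ffun=> true].
  rewrite (bigD1 [ffun=> true]) //= big1 ?addr0 // => t tn.
  rewrite [E t]F0 ?mulr0 // => card_t; case/eqP: tn; apply/ffunP => j.
  have : [set j | t j]%SET == [set: _]%SET.
    by rewrite finset.eqEcard finset.subsetT cardsT card_ord card_t leqnn.
  by move/eqP/finset.setP/(_ j); rewrite !inE ffunE.
have two0 : 2 ^+ n != 0 :> K by rewrite expf_neq0 // pnatr_eq0.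
apply: (mulfI two0); rewrite mulrCA -!inv !top.
have -> : w [ffun=> false] [ffun=> true] = 1.
  by apply: big1 => j _; rewrite !ffunE.
by rewrite mul1r /w; under eq_bigr do rewrite ffunE andbT.
Qed.

Section ComplexForm.
Local Open Scope complex_scope.
Context {R : realType} {m n : nat} (e : ('I_n -> 'rV[R]_m) -> R[i]).
Hypothesis reA : alternating (fun v => complex.Re (e v)).
Hypothesis imA : alternating (fun v => complex.Im (e v)).

Lemma calt_det (A : 'M[R]_n) (b : 'I_n -> 'rV[R]_m) :
  e (fun i => \sum_j A i j *: b j) = (\det A)%:C * e b.
Proof.
have /= r := alt_det reA A b; have /= s := alt_det imA A b.
apply/eqP; rewrite eq_complex r s.
by case: (e b) => x y /=; rewrite !mul0r subr0 addr0 !eqxx.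
Qed.

Lemma calt_scale (c : 'I_n -> R) (b : 'I_n -> 'rV[R]_m) :
  e (fun i => c i *: b i) = (\prod_i c i)%:C * e b.
Proof.
pose d : 'rV[R]_n := \row_i c i.
have -> : \prod_i c i = \det (diag_mx d).
  by rewrite det_diag; apply: eq_bigr => i _; rewrite mxE.
rewrite -calt_det; congr e; apply/funext => i.
rewrite (bigD1 i) //= big1 ?addr0; first by rewrite !mxE eqxx.
by move=> j /negPf ji; rewrite mxE eq_sym ji mulr0n scale0r.
Qed.

Variables (S : set 'rV[R]_m) (J : 'rV[R]_m -> 'rV[R]_m).
Hypothesis typeE : forall (X : 'I_n -> 'rV[R]_m) (t : {ffun 'I_n -> bool}),
  (forall j, S (X j)) -> #|[set j | t j]%SET| <> n ->
  complexified e X (fun j => if t j then - J (X j) else J (X j)) = 0.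

(* Expanding [complexified] for every sign choice [t] gives the Walsh transform
   of the values of [e]; by [walsh_top] only one coefficient survives. *)
Lemma top_type (X : 'I_n -> 'rV[R]_m) (s : 'I_n -> bool) :
  (forall j, S (X j)) ->
  e (fun j => if s j then J (X j) else X j) =
  (\prod_j (if s j then 'i else 1)) * e X.
Proof.
move=> SX.
(* The power of i is the coefficient with which the term enters [complexified]; the signs chosen by
   [t] contribute the Walsh character. *)
pose F (s : {ffun 'I_n -> bool}) : R[i] :=
  (\prod_j (if s j then 'i else 1)) * e (fun j => if s j then J (X j) else X j).
have {1}-> : s = finfun s by apply/funext => j; rewrite ffunE.
have HF (t : {ffun 'I_n -> bool}) : #|[set j | t j]%SET| <> n ->
    \sum_(u : {ffun _}) (\prod_j (if u j && t j then -1 else 1)) * F u = 0.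
  move=> tn; rewrite -[RHS](typeE SX tn) /complexified; apply: eq_bigr => u _.
  have -> : (fun j => if u j then if t j then - J (X j) else J (X j) else X j) =
     (fun j => (if u j && t j then -1 else 1) *: (if u j then J (X j) else X j)).
    by apply/funext => j; case: (u j); case: (t j);
       rewrite /= ?scaleN1r ?scale1r.
  rewrite calt_scale /F mulrCA; congr (_ * (_ * _)).
    rewrite -big_mkcond /= prodr_const.
    by congr (_ ^+ _); apply: eq_card => j; rewrite inE.
  rewrite rmorph_prod; apply: eq_bigr => j _.
  by case: ifP => _; rewrite ?rmorphN ?rmorph1.
have := walsh_top HF (finfun s).
rewrite /F.
have -> : \prod_(j < n) (if [ffun=> false] j then 'i else 1 : R[i]) = 1.
  by apply: big1 => j _; rewrite ffunE.
have -> : (fun j => if [ffun=> false] j then J (X j) else X j) = X.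
  by apply/funext => j; rewrite ffunE.
(* Each -1 is i times i: one factor cancels the i built into [F], the other remains in the
   conclusion. *)
have -> : \prod_(j < n) (if (finfun s) j then -1 else 1 : R[i]) =
   (\prod_(j < n) (if (finfun s) j then 'i else 1)) *
   \prod_(j < n) (if s j then 'i else 1).
  rewrite -big_split; apply: eq_bigr => j _ /=; rewrite ffunE.
  by case: ifP => _; rewrite ?mulr1 // -expr2 sqr_i.
rewrite mul1r -mulrA => /mulfI -> //.
apply/prodf_neq0 => j _; case: ifP => _; last exact: oner_neq0.
by rewrite eq_complex /= negb_and oner_neq0 orbT.
Qed.

Variable y : 'I_n -> 'rV[R]_m.
Hypothesis Sy : forall j, S (y j).

Definition double_frame (x : 'I_(n + n)) : 'rV[R]_m :=
  match fintype.split x with inl i => y i | inr i => J (y i) end.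

Let base (x : 'I_(n + n)) : 'I_n :=
  match fintype.split x with inl i => i | inr i => i end.
Let isr (x : 'I_(n + n)) : bool :=
  match fintype.split x with inl i => false | inr i => true end.
(** The formal value on [double_frame x] of the complex coordinate dz_j dual to [y], with [J] acting
    as i: 1 on [y j], i on [J (y j)], and 0 on the other vectors. *)
Let P (x : 'I_(n + n)) (j : 'I_n) : R[i] :=
  (if isr x then 'i else 1) * (j == base x)%:R.

(** By the type condition [J] acts as i, so along the frame [e] is [e y] times dz_1 /\ ... /\ dz_n,
    that is, times the determinant of the entries [P (f i) j]. *)
Lemma double_frame_antisym (f : 'I_n -> 'I_(n + n)) :
  e (double_frame \o f) = antisym (fun f => e y * \prod_j P (f j) j) f.
Proof.
have -> : double_frame \o f = (fun j =>
    if isr (f j) then J ((y \o (base \o f)) j) else (y \o (base \o f)) j).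
  by apply/funext => j; rewrite /= /double_frame /isr /base; case: fintype.split.
rewrite top_type; last by move=> j; exact: Sy.
have -> : y \o (base \o f) =
    (fun i => \sum_j (\matrix_i delta_mx 0 (base (f i)) : 'M[R]_n) i j *: y j).
  apply/funext => i; rewrite (bigD1 (base (f i))) //= big1 ?addr0.
    by rewrite !mxE !eqxx scale1r.
  by move=> j /negPf ji; rewrite !mxE ji andbF scale0r.
rewrite calt_det mulrA [RHS](_ : _ = (\det (\matrix_(i, j) P (f i) j)) * e y).
  congr (_ * _).
  have -> : (\matrix_(i, j) P (f i) j) =
     diag_mx (\row_i (if isr (f i) then 'i else 1)) *m
     map_mx (real_complex R) (\matrix_i delta_mx 0 (base (f i)) : 'M[R]_n).
    apply/matrixP => i j; rewrite mul_diag_mx !mxE eqxx /=.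
    by rewrite rmorph_nat.
  rewrite det_mulmx det_map_mx det_diag; congr (_ * _).
  by apply: eq_bigr => j _; rewrite mxE.
rewrite -det_tr /determinant mulr_suml; apply: eq_bigr => s _ /=.
rewrite -mulrA; congr (_ * _); rewrite mulrC; congr (_ * _).
by apply: eq_bigr => j _; rewrite !mxE.
Qed.

Lemma wedge_conj_double_frame :
  wedge e (fun v => conjc (e v)) double_frame =
  (e y * conjc (e y)) * (- 2 * 'i) ^+ n.
Proof.
transitivity (wedge (antisym (fun f => e y * \prod_j P (f j) j))
  (antisym (fun f => conjc (e y) * \prod_j conjc (P (f j) j))) id).
  rewrite -[double_frame]/(double_frame \o id) /wedge; congr (_ * _).
  apply: eq_bigr => s _; congr (_ * _ * _).
    by rewrite -double_frame_antisym.
  rewrite [X in conjc X](double_frame_antisym (id \o (s \o @rshift n n))).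
  rewrite /antisym rmorph_sum; apply: eq_bigr => t _.
  by rewrite rmorphM rmorph_sign rmorphM rmorph_prod.
rewrite wedge_antisym /antisym.
(* The rows of [Z] are the coordinates dz_j and their conjugates on the frame (y, J y). Subtracting
   the upper rows from the lower ones gives the determinant (-2i)^n. *)
pose Z : 'M[R[i]]_(n + n) := block_mx 1%:M 'i%:M 1%:M (- 'i)%:M.
transitivity (e y * (e y)^* * \det Z).
  rewrite /determinant mulr_sumr; apply: eq_bigr => s _.
  rewrite big_split_ord /= [RHS]mulrCA -!mulrA; congr (_ * (_ * _)).
  rewrite mulrCA; congr (_ * (_ * _)); apply: eq_bigr => j _ /=.
    rewrite /P /isr /base.
    case: (split_ordP (s _)) => l ->; rewrite ?block_mxEul ?block_mxEur mxE.
      by rewrite mul1r.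
    by rewrite mulr_natr.
  rewrite /P /isr /base.
  case: (split_ordP (s _)) => l ->; rewrite ?block_mxEdl ?block_mxEdr mxE.
    by rewrite mul1r rmorph_nat.
  rewrite rmorphM rmorph_nat /= mulr_natr; congr (_ *+ _).
  by apply/eqP; rewrite eq_complex /= oppr0 !eqxx.
congr (_ * _).
have -> : Z = block_mx 1%:M 0 1%:M 1%:M *m block_mx 1%:M 'i%:M 0 (- 2 * 'i)%:M.
  rewrite mulmx_block !mul1mx !mul0mx !addr0 -raddfD /=.
  congr (block_mx _ _ _ _); congr (_%:M).
  by rewrite mulNr mulr2n mulrDl mul1r opprD addrA subrr sub0r.
by rewrite det_mulmx det_lblock det_ublock !det1 !mul1r det_scalar.
Qed.

Lemma orth_norm_sq (a : ('I_2 -> 'rV[R]_m) -> R) (g : 'I_n -> R) :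
  (forall v, cast_degree (addnn n) (wedge e (fun v' => conjc (e v'))) v =
     c_ R n * (wedge_exp a n v / n`!%:R)%:C) ->
  (forall i j, a (two (y i) (y j)) = 0) ->
  (forall i j, a (two (J (y i)) (J (y j))) = 0) ->
  (forall i j, a (two (y i) (J (y j))) = g i *+ (i == j)) ->
  (forall i j, a (two (J (y i)) (y j)) = - g i *+ (i == j)) ->
  (forall i, 0 <= g i) ->
  complex.Re (e y) ^+ 2 + complex.Im (e y) ^+ 2 = \prod_i g i.
Proof.
move=> vol all arr alr arl g0.
have Wl i : double_frame (lshift n i) = y i.
  by rewrite /double_frame (unsplitK (inl _)).
have Wr i : double_frame (rshift n i) = J (y i).
  by rewrite /double_frame (unsplitK (inr _)).
have := vol (double_frame \o cast_ord (esym (addnn n))).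
rewrite /cast_degree.
have -> : (fun i => (double_frame \o cast_ord (esym (addnn n)))
    (cast_ord (addnn n) i)) = double_frame.
  by apply/funext => i /=; rewrite cast_ordK.
rewrite wedge_conj_double_frame (@wedge_exp_pairs _ _ g); last 4 first.
- by move=> i j; rewrite !Wl.
- by move=> i j; rewrite !Wr.
- by move=> i j; rewrite Wl Wr.
- by move=> i j; rewrite Wl Wr.
set N := _ + _; set G := \prod_i _; set sg := (-1) ^+ _.
have -> : e y * conjc (e y) = N%:C.
  rewrite /N; case: (e y) => u v /=; apply/eqP; rewrite eq_complex /=.
  by apply/andP; split; apply/eqP; ring.
have n0 : n`!%:R != 0 :> R by rewrite pnatr_eq0 -lt0n fact_gt0.
(* Squaring removes the sign of [interleave] and the one in [c_], and leaves a factor (-4)^n on both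
   sides. As [N] and [G] are nonnegative, they can be recovered from their squares. *)
rewrite [sg * _ * G]mulrAC mulfK // => /(congr1 (fun z => z ^+ 2)).
have i4 : (2 * 'i) ^+ 2 = - 4 :> R[i].
  by rewrite exprMn sqr_i mulrN1 -natrX.
rewrite /c_ !exprMn sqrr_sign mul1r -!exprM [(n * 2)%N]mulnC !exprM.
rewrite sqrrN -!exprMn i4 mulrC => /mulfI.
have -> : (- 4 : R[i]) ^+ n != 0 by rewrite expf_neq0 // oppr_eq0 pnatr_eq0.
move=> /(_ isT); rewrite -!rmorphXn => /(congr1 (@complex.Re R)) /=.
rewrite exprMn sqrr_sign mul1r => /eqP.
by rewrite eqrXn2 ?prodr_ge0 ?addr_ge0 ?sqr_ge0 // => /eqP.
Qed.

End ComplexForm.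

(** * Gram-Schmidt orthogonalization *)

Section GramSchmidt.
Context {R : realType} {V : lmodType R} (S : set V) (J : V -> V).
Variable g : V -> V -> R.
Hypothesis S0 : S 0.
Hypothesis SL : forall c u v, S u -> S v -> S (c *: u + v).
Hypothesis SJ : forall v, S v -> S (J v).
Hypothesis gl : forall c u v w, g (c *: u + v) w = c * g u w + g v w.
Hypothesis gr : forall c u v w, g w (c *: u + v) = c * g w u + g w v.
Hypothesis gC : forall u v, S u -> S v -> g u v = g v u.
Hypothesis gpos : forall v, S v -> v != 0 -> 0 < g v v.
Hypothesis gJ : forall u v, S u -> S v -> g (J u) v = - g u (J v).
Hypothesis gJJ : forall u v, S u -> S v -> g u v = 0 -> g (J u) (J v) = 0.

Lemma form0l w : g 0 w = 0.
Proof. by have := gl (-1) 0 0 w; rewrite scaler0 addr0 mulN1r addNr. Qed.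

Lemma form0r w : g w 0 = 0.
Proof. by have := gr (-1) 0 0 w; rewrite scaler0 addr0 mulN1r addNr. Qed.

Lemma formDl u v w : g (u + v) w = g u w + g v w.
Proof. by have := gl 1 u v w; rewrite scale1r mul1r. Qed.

Lemma formDr u v w : g w (u + v) = g w u + g w v.
Proof. by have := gr 1 u v w; rewrite scale1r mul1r. Qed.

Lemma formZl c u w : g (c *: u) w = c * g u w.
Proof. by have := gl c u 0 w; rewrite !addr0 form0l addr0. Qed.

Lemma form_suml (I : finType) (P : pred I) (F : I -> V) w :
  g (\sum_(i | P i) F i) w = \sum_(i | P i) g (F i) w.
Proof.
elim/big_rec2: _ => [|i x y _ <-]; first exact: form0l.
exact: formDl.
Qed.

Lemma form_ge0 v : S v -> 0 <= g v v.
Proof.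
by move=> Sv; have [->|/gpos/ltW] := eqVneq v 0; [rewrite form0l|apply].
Qed.

Lemma form_JJ0 v : S v -> g v (J v) = 0.
Proof.
move=> Sv; have := gJ Sv Sv; rewrite (gC (SJ Sv) Sv) => /eqP.
by rewrite -addr_eq0 -mulr2n mulrn_eq0 => /eqP.
Qed.

(** The identity persists at [v = 0], where division by zero gives 0; this lets linearly dependent
    families be orthogonalized. *)
Lemma form_proj x v : S v -> g x v - g x v / g v v * g v v = 0.
Proof.
move=> Sv; have [->|v0] := eqVneq v 0; first by rewrite !form0r mulr0 subrr.
by rewrite divfK ?subrr // gt_eqF ?gpos.
Qed.

Context {n : nat} {T : Type} (f : ('I_n -> V) -> T).
(** [f] stands for a quantity that survives an elementary step, in which combinations of the other
    vectors and of their images under [J] are subtracted from one vector. It will be a form of type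
    (n, 0) or a determinant. *)
Hypothesis fE : forall (y : 'I_n -> V) k (a b : 'I_n -> R),
  (forall i, S (y i)) ->
  f (upd y k (y k - \sum_(j | j != k) (a j *: y j + b j *: J (y j)))) = f y.

(* With [J = 0] this is the real Gram-Schmidt process. *)
Lemma gram_schmidt (x : 'I_n -> V) : (forall i, S (x i)) ->
  exists y : 'I_n -> V, [/\ forall i, S (y i), f y = f x,
    forall i j, i != j -> g (y i) (y j) = 0 /\ g (y i) (J (y j)) = 0 &
    forall i, g (y i) (y i) <= g (x i) (x i)].
Proof.
move=> Sx.
have H k : (k <= n)%N -> exists y : 'I_n -> V, [/\ forall i, S (y i), f y = f x,
    forall i j : 'I_n, (i < k)%N -> (j < k)%N -> i != j ->
      g (y i) (y j) = 0 /\ g (y i) (J (y j)) = 0,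
    forall i, g (y i) (y i) <= g (x i) (x i) &
    forall i : 'I_n, (k <= i)%N -> y i = x i]; last first.
  have [y [Sy fy oy ly _]] := H n (leqnn n).
  by exists y; split=> // i j; apply: oy; exact: ltn_ord.
elim: k => [_|k IH kn]; first by exists x; split.
have [y [Sy fy oy ly xy]] := IH (ltnW kn).
pose k0 := Ordinal kn; have xk : y k0 = x k0 by exact: xy.
(* Coefficients of the projection of [y k0] onto the complex span of the vectors already treated.
   They are set to 0 from index [k] on, so that the sum can run over all j distinct from [k0], as in
   [fE]. *)
pose a (j : 'I_n) := if (j < k)%N then g (y k0) (y j) / g (y j) (y j) else 0.
pose b (j : 'I_n) := if (j < k)%N then
   g (y k0) (J (y j)) / g (J (y j)) (J (y j)) else 0.
pose w := \sum_(j | j != k0) (a j *: y j + b j *: J (y j)).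
pose z := y k0 - w.
have Sw : S w.
  rewrite /w; elim/big_ind: _ => // [u v Su Sv|j _].
    by rewrite -[u]scale1r; exact: SL.
  by apply: SL => //; rewrite -[_ *: _]addr0; apply: SL => //; exact: SJ.
have Sz : S z by rewrite /z addrC -scaleN1r; exact: SL.
have jk (j : 'I_n) : (j < k)%N -> j != k0.
  by move=> jk; apply/eqP => e; rewrite e ltnn in jk.
have gz v : g z v = g (y k0) v - g w v.
  by rewrite /z addrC -scaleN1r gl mulN1r addrC.
have zy (l : 'I_n) : (l < k)%N -> g z (y l) = 0.
  move=> lk; rewrite gz /w form_suml (bigD1 l) ?jk //= big1 ?addr0; last first.
    move=> j /andP[jk0 jl]; rewrite gl formZl gJ //.
    rewrite /a /b; case: ifP => jk'; last by rewrite !mul0r addr0.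
    by have [-> ->] := oy j l jk' lk jl; rewrite oppr0 !mulr0 addr0.
  by rewrite gl formZl gJ // form_JJ0 // oppr0 mulr0 addr0 /a lk form_proj.
have zJy (l : 'I_n) : (l < k)%N -> g z (J (y l)) = 0.
  move=> lk; rewrite gz /w form_suml (bigD1 l) ?jk //= big1 ?addr0; last first.
    move=> j /andP[jk0 jl]; rewrite gl formZl.
    rewrite /a /b; case: ifP => jk'; last by rewrite !mul0r addr0.
    have [e ->] := oy j l jk' lk jl.
    by rewrite (gJJ (Sy j) (Sy l) e) !mulr0 addr0.
  by rewrite gl formZl form_JJ0 // mulr0 add0r /b lk form_proj //; exact: SJ.
have zw : g z w = 0.
  rewrite gC // /w form_suml big1 // => j _; rewrite gl formZl.
  rewrite /a /b; case: ifP => jk'; last by rewrite !mul0r addr0.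
  by rewrite (gC (Sy j) Sz) zy // (gC (SJ (Sy j)) Sz) zJy // !mulr0 addr0.
(* Pythagoras: [y k0] is the orthogonal sum of [z] and [w]. *)
have le_z : g z z <= g (y k0) (y k0).
  have -> : y k0 = z + w by rewrite /z subrK.
  rewrite formDl (formDr z w z) (formDr z w w) zw addr0 [g w z]gC // zw add0r lerDl.
  exact: form_ge0.
exists (upd y k0 z); split.
- by move=> i; rewrite /upd; case: eqP.
- by rewrite fE.
- move=> i j; rewrite /upd !ltnS.
  have [->|ik] := eqVneq i k0; have [->|jk0] := eqVneq j k0; rewrite ?eqxx //.
  + move=> _ jk1 _; have jk' : (j < k)%N.
      rewrite ltn_neqAle jk1 andbT; apply: contra_neqN jk0 => /eqP e.
      exact/val_inj.
    by rewrite zy ?zJy.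
  + move=> ik1 _ _; have ik' : (i < k)%N.
      rewrite ltn_neqAle ik1 andbT; apply: contra_neqN ik => /eqP e.
      exact/val_inj.
    rewrite gC // zy //; split => //.
    have := gJ (Sy i) Sz; rewrite (gC (SJ (Sy i)) Sz) zJy // => /eqP.
    by rewrite eq_sym oppr_eq0 => /eqP.
  + move=> ik1 jk1; apply: oy; rewrite ltn_neqAle ?ik1 ?jk1 andbT.
      by apply: contra_neqN ik => /eqP e; exact/val_inj.
    by apply: contra_neqN jk0 => /eqP e; exact/val_inj.
- move=> i; rewrite /upd; case: eqP => [->|_ //]; apply: le_trans (ly k0).
  by rewrite -/k0.
- move=> i ki; rewrite updN; first by apply/xy/ltnW.
  by apply/eqP => e; rewrite e ltnn in ki.
Qed.

End GramSchmidt.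

(** * Calculus in charts *)

Section Schwarz.
Context {R : realType} {V : normedModType R}.

Lemma line_is_derive (f : V -> R) (p d : V) (s : R) :
  derivable f (p + s *: d) d ->
  is_derive s (1 : R) (fun t : R => f (p + t *: d)) ('D_d f (p + s *: d)).
Proof.
move=> df.
have E : (fun h : R => h^-1 *:
    (((fun t : R => f (p + t *: d)) \o shift s) (h *: (1 : R))
     - f (p + s *: d))) =
         (fun h => h^-1 *: ((f \o shift (p + s *: d)) (h *: d) - f (p + s *: d))).
  apply/funext => h /=; congr (_ *: (f _ - _)).
  by rewrite [_ *: 1]mulr1 scalerDl addrCA.
by split; rewrite /derivable /derive E.
Qed.

Lemma mvt_line (f : V -> R) (p d : V) (h : R) : 0 <= h ->
  (forall s, 0 <= s <= h -> derivable f (p + s *: d) d) ->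
  exists2 c, 0 <= c <= h & f (p + h *: d) - f p = 'D_d f (p + c *: d) * h.
Proof.
move=> h0 df.
have idf s : 0 <= s <= h ->
    is_derive s (1 : R) (fun t : R => f (p + t *: d)) ('D_d f (p + s *: d)).
  by move=> sh; exact/line_is_derive/df.
have := @MVT_segment R (fun t => f (p + t *: d)) (fun t => 'D_d f (p + t *: d)) 0 h h0.
case.
- by move=> x; rewrite in_itv /= => /andP[x0 xh]; apply: idf; rewrite !ltW.
- apply: derivable_within_continuous => x; rewrite in_itv /= => xh.
  by have [] := idf x xh.
move=> c; rewrite in_itv /= => ch; rewrite scale0r addr0 subr0 => e.
by exists c.
Qed.

(** The mean value theorem is used twice: along [v] for the increment of [f] by [h *: w], then along
    [w] for ['D_v f]. *)
Lemma second_difference (f : V -> R) (y v w : V) (h : R) : 0 < h ->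
  (forall s t, 0 <= s <= h -> 0 <= t <= h ->
     [/\ derivable f (y + s *: v + t *: w) v &
         derivable ('D_v f) (y + s *: v + t *: w) w]) ->
  exists s t, [/\ 0 <= s <= h, 0 <= t <= h &
    (f (y + h *: v + h *: w) - f (y + h *: v)) - (f (y + h *: w) - f y) =
    'D_w ('D_v f) (y + s *: v + t *: w) * h * h].
Proof.
move=> h0 df; have hh : 0 <= h <= h by rewrite lexx ltW.
have oh : 0 <= (0 : R) <= h by rewrite lexx ltW.
pose F z := f (z + h *: w) - f z.
have F1 s : 0 <= s <= h -> derivable (fun z => f (z + h *: w)) (y + s *: v) v /\
    'D_v (fun z => f (z + h *: w)) (y + s *: v) = 'D_v f (y + s *: v + h *: w).
  move=> sh; have [d1 _] := df s h sh hh.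
  have E : (fun k : R => k^-1 *:
      (((fun z => f (z + h *: w)) \o shift (y + s *: v)) (k *: v)
       - f (y + s *: v + h *: w))) =
       (fun k => k^-1 *: ((f \o shift (y + s *: v + h *: w)) (k *: v)
          - f (y + s *: v + h *: w))).
    by apply/funext => k /=; rewrite -!addrA.
  by split; rewrite /derivable /derive E.
have F2 s : 0 <= s <= h -> derivable f (y + s *: v) v.
  by move=> sh; have [] := df s 0 sh oh; rewrite scale0r addr0.
have [s sh es] : exists2 s, 0 <= s <= h &
    F (y + h *: v) - F y = 'D_v F (y + s *: v) * h.
  apply: mvt_line; first exact: ltW.
  by move=> s sh; apply: derivableB; [have [] := F1 s sh|exact: F2].
have [t th et] : exists2 t, 0 <= t <= h &
    'D_v f (y + s *: v + h *: w) - 'D_v f (y + s *: v) =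
    'D_w ('D_v f) (y + s *: v + t *: w) * h.
  apply: mvt_line; first exact: ltW.
  by move=> t th; have [] := df s t sh th.
exists s, t; split=> //; rewrite -[LHS]/(F (y + h *: v) - F y) es -et.
have [d1 e1] := F1 s sh.
by rewrite /F deriveB ?e1 //; exact: F2.
Qed.

(** The second difference over the parallelogram with sides [h *: v] and [h *: w] is symmetric in
    [v] and [w]. Hence the two iterated derivatives take a common value at points close to [y], and
    continuity brings the equality to [y]. *)
Lemma schwarz (f : V -> R) (y v w : V) :
  (\forall z \near y, [/\ derivable f z v, derivable f z w,
     derivable ('D_v f) z w & derivable ('D_w f) z v]) ->
  {for y, continuous ('D_w ('D_v f))} -> {for y, continuous ('D_v ('D_w f))} ->
  'D_w ('D_v f) y = 'D_v ('D_w f) y.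
Proof.
move=> df cA cB; set A := 'D_w ('D_v f); set B := 'D_v ('D_w f).
apply/eqP; rewrite -subr_eq0 -normr_le0; apply/ler_addgt0Pl => e e0.
rewrite addr0.
have e2 : 0 < e / 2 by rewrite divr_gt0.
have cA2 : \forall z \near y, `|A y - A z| < e / 2.
  move/cvgrPdist_lt : cA => /(_ _ e2). exact.
have cB2 : \forall z \near y, `|B y - B z| < e / 2.
  move/cvgrPdist_lt : cB => /(_ _ e2). exact.
have : \forall z \near y, [/\ [/\ derivable f z v, derivable f z w,
     derivable ('D_v f) z w & derivable ('D_w f) z v],
     `|A y - A z| < e / 2 & `|B y - B z| < e / 2].
  by apply: filterS3 df cA2 cB2 => z; split.
move=> /nbhs_ballP[r /= r0 rP].
(* The size [h] keeps the parallelogram within the ball of radius [r]; the added 1 keeps the divisor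
   positive when [v] and [w] vanish. *)
pose N := `|v| + `|w| + 1; have N0 : 0 < N by rewrite ltr_wpDl ?addr_ge0.
pose h := r / 2 / N; have h0 : 0 < h by rewrite !divr_gt0.
have inb s t : 0 <= s <= h -> 0 <= t <= h -> ball y r (y + s *: v + t *: w).
  move=> /andP[s0 sh] /andP[t0 th].
  rewrite -ball_normE /= -addrA opprD addrA subrr sub0r normrN.
  apply: le_lt_trans (ler_normD _ _) _; rewrite !normrZ !ger0_norm //.
  apply: (@le_lt_trans _ _ (h * (`|v| + `|w|))).
    by rewrite mulrDr lerD // ler_wpM2r.
  apply: (@le_lt_trans _ _ (h * N)); first by rewrite ler_pM2l // lerDl.
  by rewrite /h divfK ?gt_eqF // ltr_pdivrMr // ltr_pMr // ltr1n.
have [s [t [sh th e1]]] := @second_difference f y v w h h0 (fun s t sh th =>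
  let: And3 (And4 a b c d) _ _ := rP _ (inb s t sh th) in conj a c).
have inb' s' t' : 0 <= s' <= h -> 0 <= t' <= h -> ball y r (y + s' *: w + t' *: v).
  by move=> s'h t'h; rewrite addrAC; exact: inb.
have [s' [t' [sh' th' e3]]] := @second_difference f y w v h h0 (fun s t sh th =>
  let: And3 (And4 a b c d) _ _ := rP _ (inb' s t sh th) in conj b d).
have AB : A (y + s *: v + t *: w) = B (y + s' *: w + t' *: v).
  have : A (y + s *: v + t *: w) * h * h = B (y + s' *: w + t' *: v) * h * h.
    apply: etrans (esym e1) _; apply: etrans _ e3.
    rewrite [y + h *: w + h *: v]addrAC.
    by move: (f _) (f _) (f _) (f _) => p1 p2 p3 p4; ring.
  by move/(mulIf (lt0r_neq0 h0))/(mulIf (lt0r_neq0 h0)).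
have [_ a1 _] := rP _ (inb _ _ sh th).
have [_ _ b1] := rP _ (inb' _ _ sh' th').
rewrite (_ : A y - B y = (A y - A (y + s *: v + t *: w)) -
  (B y - B (y + s' *: w + t' *: v))); last first.
  by rewrite AB; move: (A y) (B y) (B _) => p1 p2 p3; ring.
apply: le_trans (ler_normB _ _) _; rewrite [leRHS]splitr.
exact: lerD (ltW a1) (ltW b1).
Qed.

End Schwarz.

Section SmoothOn.
Context {R : realType} {n m : nat}.

Lemma smooth_on_differentiable (W : normedModType R) (U : set 'rV[R]_n)
    (f : 'rV[R]_n -> W) y : smooth_on U f -> U y -> differentiable f y.
Proof. by move=> /(_ 1%N) [+ _]; apply. Qed.

Lemma smooth_on_continuous (W : normedModType R) (U : set 'rV[R]_n)
    (f : 'rV[R]_n -> W) y : smooth_on U f -> U y -> {for y, continuous f}.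
Proof. by move=> /(_ 0%N); apply. Qed.

Lemma smooth_on_derive (W : normedModType R) (U : set 'rV[R]_n)
    (f : 'rV[R]_n -> W) v : smooth_on U f -> smooth_on U ('D_v f).
Proof. by move=> fU k; have [_] := fU k.+1; apply. Qed.

Lemma near_eq_continuous (V W : topologicalType) (f g : V -> W) (y : V) :
  (\near y, f y = g y) -> {for y, continuous f} -> {for y, continuous g}.
Proof.
move=> fg cf; rewrite /prop_for /continuous_at -(nbhs_singleton fg).
exact/(cvg_trans _ cf)/near_eq_cvg.
Qed.

Lemma derive_coord (f : 'rV[R]_n -> 'rV[R]_m) y v j :
  derivable f y v -> 'D_v (fun z => f z ord0 j) y = ('D_v f y) ord0 j.
Proof. by move=> df; rewrite derive_mx // mxE. Qed.

Lemma derivable_coord (f : 'rV[R]_n -> 'rV[R]_m) y v j :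
  derivable f y v -> derivable (fun z => f z ord0 j) y v.
Proof. by move=> /derivable_mxP; apply. Qed.

Lemma smooth_schwarz (U : set 'rV[R]_n) (f : 'rV[R]_n -> 'rV[R]_m) y v w :
  open U -> smooth_on U f -> U y -> 'D_w ('D_v f) y = 'D_v ('D_w f) y.
Proof.
move=> oU fU Uy.
have nU z : U z -> \forall z' \near z, U z' by move=> Uz; exact: open_nbhs_nbhs.
have df z v' : U z -> derivable f z v'.
  by move=> Uz; apply/diff_derivable/(smooth_on_differentiable fU).
have ddf z v' w' : U z -> derivable ('D_v' f) z w'.
  move=> Uz; apply/diff_derivable/(smooth_on_differentiable _ Uz).
  exact: smooth_on_derive.
apply/rowP => j; pose fj z := f z ord0 j.
have E1 v' z : U z -> \forall z' \near z, ('D_v' f z') ord0 j = 'D_v' fj z'.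
  by move=> /nU; apply: filterS => z' Uz'; rewrite derive_coord //; exact: df.
have E2 v' w' z : U z -> 'D_w' ('D_v' fj) z = ('D_w' ('D_v' f) z) ord0 j.
  move=> Uz; rewrite -derive_coord; last exact: ddf.
  by apply/esym/near_eq_derive/E1.
have C v' w' : {for y, continuous ('D_w' ('D_v' fj))}.
  have nE : \forall z \near y, ('D_w' ('D_v' f) z) ord0 j = 'D_w' ('D_v' fj) z.
    by apply: filterS (nU _ Uy) => z Uz; rewrite E2.
  apply: near_eq_continuous nE _.
  apply: (@continuous_comp _ _ _ ('D_w' ('D_v' f)) (fun M : 'rV[R]_m => M ord0 j)).
    apply: (smooth_on_continuous _ Uy).
    exact/smooth_on_derive/smooth_on_derive.
  exact: coord_continuous.
apply: etrans (esym (E2 v w y Uy)) _; apply: etrans _ (E2 w v y Uy).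
apply: schwarz; [|exact: C|exact: C].
apply: filterS (nU _ Uy) => z Uz; split.
- exact/derivable_coord/df.
- exact/derivable_coord/df.
- by apply: near_eq_derivable (E1 v z Uz) _; exact/derivable_coord/ddf.
- by apply: near_eq_derivable (E1 w z Uz) _; exact/derivable_coord/ddf.
Qed.

(** Differentiating the vanishing pullback expresses each side by second derivatives of [F], which
    are symmetric. This is the commutation of d with pullback, for a 1-form with components [a]
    whose pullback is zero. *)
Lemma pullback1_closed (U : set 'rV[R]_n) (F : 'rV[R]_n -> 'rV[R]_m) z
    (a : 'I_m -> 'rV[R]_m -> R) :
  open U -> smooth_on U F -> U z -> (forall j, differentiable (a j) (F z)) ->
  (forall z' v, U z' -> \sum_j ('D_v F z') ord0 j * a j (F z') = 0) ->
  forall v w,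
  \sum_j ('D_w F z) ord0 j * 'D_('D_v F z) (a j) (F z) =
  \sum_j ('D_v F z) ord0 j * 'D_('D_w F z) (a j) (F z).
Proof.
move=> oU FU Uz da a0 v w.
have dF := smooth_on_differentiable FU Uz.
suff key v' w' : \sum_j ('D_w' F z) ord0 j * 'D_('D_v' F z) (a j) (F z) =
    - \sum_j ('D_v' ('D_w' F) z) ord0 j * a j (F z).
  apply: etrans (key v w) _; apply: etrans _ (esym (key w v)).
  apply: (congr1 (fun x : R => - x)).
  apply: eq_bigr => j _.
  apply: (congr1 (fun M : 'rV[R]_m => M ord0 j * a j (F z))
                 (smooth_schwarz w v oU FU Uz)).
pose h (j : 'I_m) : 'rV[R]_n -> R :=
  (fun z => ('D_w' F z) ord0 j) * (fun z => a j (F z)).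
have dh j : is_derive z v' (h j)
  (('D_w' F z) ord0 j *: 'D_('D_v' F z) (a j) (F z)
   + a j (F z) *: ('D_v' ('D_w' F) z) ord0 j).
  have dd : derivable ('D_w' F) z v'.
    apply/diff_derivable/(smooth_on_differentiable _ Uz).
    exact: smooth_on_derive.
  have i1 : is_derive z v' (fun z => ('D_w' F z) ord0 j) (('D_v' ('D_w' F) z) ord0 j).
    by split; [exact: derivable_coord|exact: derive_coord].
  have i2 : is_derive z v' (fun z => a j (F z)) ('D_('D_v' F z) (a j) (F z)).
    have dc : differentiable (a j \o F) z by exact: differentiable_comp.
    split; first exact: diff_derivable.
    by rewrite (deriveE _ dc) diff_comp //= !deriveE.
  exact: is_deriveM.
have [_ ds] : is_derive z v' (\sum_j h j) (\sum_(j < m)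
   (('D_w' F z) ord0 j *: 'D_('D_v' F z) (a j) (F z)
   + a j (F z) *: ('D_v' ('D_w' F) z) ord0 j)) by exact: is_derive_sum.
have h0 : 'D_v' (\sum_j h j) z = 0.
  rewrite (@near_eq_derive _ _ _ _ (cst 0)) ?derive_cst //.
  apply: filterS (open_nbhs_nbhs (conj oU Uz)) => z' Uz'.
  rewrite fct_sumE; exact: (a0 z' w' Uz').
move: ds; rewrite h0 big_split /= => /esym/eqP; rewrite addr_eq0 => /eqP ->.
by congr (- _); apply: eq_bigr => j _; rewrite mulrC.
Qed.

Lemma alternating_linear_comp p k (a : ('I_k -> 'rV[R]_m) -> R)
    (h : {linear 'rV[R]_p -> 'rV[R]_m}) :
  alternating a -> alternating (fun v => a (h \o v)).
Proof.
move=> [aL a0]; split=> [v i c u w|v i j ij vij]; last first.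
  by apply: (a0 _ i j) => //=; rewrite vij.
have E x : h \o upd v i x = upd (h \o v) i (h x).
  by apply/funext => l; rewrite /upd /=; case: eqP.
by rewrite !E linearP aL.
Qed.

(** Slots become variable one at a time: the new entry is expanded in coordinates, which leaves
    continuous coefficients times values with a constant vector in that slot. *)
Lemma alternating_continuous k (z : 'rV[R]_n)
    (B : 'rV[R]_n -> ('I_k -> 'rV[R]_m) -> R) (c : 'I_k -> 'rV[R]_n -> 'rV[R]_m) :
  (forall z, alternating (B z)) ->
  (forall v, {for z, continuous (fun z => B z v)}) ->
  (forall i, {for z, continuous (c i)}) ->
  {for z, continuous (fun z => B z (fun i => c i z))}.
Proof.
move=> BA cB cc.
have H l : (l <= k)%N -> forall v, {for z, continuous (fun z' =>
    B z' (fun i => if (i < l)%N then c i z' else v i))}; last first.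
  have -> : (fun z => B z (fun i => c i z)) =
      (fun z' => B z' (fun i => if (i < k)%N then c i z' else 0)).
    apply/funext => z'; congr (B z' _); apply/funext => i.
    by rewrite ltn_ord.
  exact: H.
elim: l => [_ v|l IH lk v]; first exact: cB.
pose i0 := Ordinal lk.
pose u z' (i : 'I_k) := if (i < l)%N then c i z' else v i.
have -> : (fun z' => B z' (fun i => if (i < l.+1)%N then c i z' else v i)) =
    (fun z' => \sum_j (c i0 z') ord0 j * B z' (upd (u z') i0 (delta_mx 0 j))).
  apply/funext => z'.
  have -> : (fun i : 'I_k => if (i < l.+1)%N then c i z' else v i) =
      upd (u z') i0 (c i0 z').
    apply/funext => i; rewrite /u /upd; have [->|ii0] := eqVneq i i0.
      by rewrite /= ltnSn.
    rewrite ltnS leq_eqVlt; case: eqP => //= e.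
    by case/eqP: ii0; apply/val_inj.
  rewrite {1}[c i0 z']row_sum_delta alt_sum //; apply: eq_bigr => j _.
  by rewrite altZ.
have cs : continuous (fun x : R * R => x.1 + x.2) by exact: add_continuous.
apply: (@cvg_big _ _ _ _ _ cs _ (nbhs z) _ _ _ (nbhs_filter z)) => j _.
suff cB' : {for z, continuous (fun z' => B z' (upd (u z') i0 (delta_mx 0 j)))}.
  apply: (@continuousM R _ (fun z' => (c i0 z') ord0 j)) => //.
  apply: (@continuous_comp _ _ _ (c i0) (fun M : 'rV[R]_m => M ord0 j)) => //.
  exact: coord_continuous.
have -> : (fun z' => B z' (upd (u z') i0 (delta_mx 0 j))) =
    (fun z' => B z' (fun i : 'I_k => if (i < l)%N then c i z'
                                     else upd v i0 (delta_mx 0 j) i)).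
  apply/funext => z'; congr (B z' _); apply/funext => i.
  rewrite /u /upd; have [->|//] := eqVneq i i0.
  by rewrite /= ltnn.
exact: IH (ltnW lk) _.
Qed.

End SmoothOn.

(** * Charts of manifolds and pullbacks of forms *)

Section ChartCalculus.
Context {R : realType}.
Local Open Scope classical_set_scope.
Local Notation dom x := (chart_dom (chart_at x)).
Local Notation img x := (chart_img (chart_at x)).
Local Notation phi x := (chart_map (chart_at x)).
Local Notation psi x := (chart_inv (chart_at x)).

Lemma near_eq_diff n m (f g : 'rV[R]_n -> 'rV[R]_m) z v :
  (\near z, f z = g z) -> differentiable f z -> differentiable g z ->
  'd f z v = 'd g z v.
Proof.
move=> fg df dg; apply: etrans (esym (deriveE v df)) _.
apply: etrans _ (deriveE v dg); exact: near_eq_derive.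
Qed.

Section OneManifold.
Context {m : nat} {M : manifold R m}.

Lemma chart_psiK (a q : M) : dom a q -> psi a (phi a q) = q.
Proof. by move=> aq; exact: (chart_mapK (man_chart a)). Qed.

Lemma chart_img_phi (a q : M) : dom a q -> img a (phi a q).
Proof. by move=> aq; exists q. Qed.

Lemma near_img (a : M) z : img a z -> \forall z' \near z, img a z'.
Proof.
move=> az; apply: open_nbhs_nbhs; split=> //.
exact: (chart_img_open (man_chart a)).
Qed.

Lemma near_dom (a q : M) : dom a q -> \forall q' \near q, dom a q'.
Proof.
move=> aq; apply: open_nbhs_nbhs; split=> //.
exact: (chart_dom_open (man_chart a)).
Qed.

Lemma near_psi (a q : M) (P : set M) : dom a q -> (\forall q' \near q, P q') ->
  \forall z \near phi a q, P (psi a z).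
Proof.
move=> aq Pq; apply: (chart_inv_cont (man_chart a) (chart_img_phi aq)).
by rewrite /= chart_psiK.
Qed.

Lemma transition_differentiable (a b q : M) : dom a q -> dom b q ->
  differentiable (phi b \o psi a) (phi a q).
Proof.
move=> aq bq; apply: smooth_on_differentiable (man_smooth a b) _.
by exists q.
Qed.

Lemma chg_id (a q : M) v : dom a q -> chg a a q v = v.
Proof.
move=> aq; rewrite /chg (@near_eq_diff _ _ _ id) //.
- by rewrite diff_val.
- apply: filterS (near_img (chart_img_phi aq)) => z [q' aq' <-] /=.
  by rewrite chart_psiK.
- exact: transition_differentiable.
Qed.

Lemma loc_form_alternating k (w : dform R M k) (x : M) y :
  is_form w -> alternating (loc_form w x y).
Proof.
move=> [wA _]; rewrite /loc_form.
exact: (alternating_linear_comp ('d (phi (psi x y) \o psi x) (phi x (psi x y)))).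
Qed.

Lemma ext_two (w : dform R M 1) x u v : ext w x (two u v) =
  'D_u (fun y => loc_form w x y (fun=> v)) (phi x x)
  - 'D_v (fun y => loc_form w x y (fun=> u)) (phi x x).
Proof.
rewrite /ext !big_ord_recl big_ord0 addr0 expr0 expr1 mul1r mulN1r.
have e1 : (fun y => loc_form w x y (fun j : 'I_1 => two u v (lift ord0 j))) =
    (fun y => loc_form w x y (fun=> v)).
  by apply/funext => y; congr loc_form.
have e2 : (fun y => loc_form w x y
      (fun j : 'I_1 => two u v (lift (lift ord0 ord0) j))) =
    (fun y => loc_form w x y (fun=> u)).
  by apply/funext => y; congr loc_form; apply/funext => j; rewrite (ord1 j).
by rewrite e1 e2 /two /=.
Qed.

End OneManifold.

Section Pullback.
Context {n m : nat} {L : manifold R n} {M : manifold R m} {p : L -> M}.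
Hypothesis ps : smooth_map p.

Definition local_map (u : L) (x : M) : 'rV[R]_n -> 'rV[R]_m :=
  phi x \o p \o psi u.

Definition local_dom (u : L) (x : M) : set 'rV[R]_n :=
  phi u @` (dom u `&` p @^-1` dom x).

Lemma local_map_smooth (u : L) (x : M) :
  smooth_on (local_dom u x) (local_map u x).
Proof. by have [_] := ps; apply. Qed.

Lemma near_dom_preim (u q : L) (x : M) : dom u q -> dom x (p q) ->
  \forall q' \near q, dom u q' /\ dom x (p q').
Proof.
move=> uq xpq; apply: filterI; first exact: near_dom.
by have [cp _] := ps; apply: cp; exact: near_dom.
Qed.

Lemma local_dom_open (u : L) (x : M) : open (local_dom u x).
Proof.
rewrite openE => _ [q [uq xq] <-].
have h1 := near_psi uq (near_dom_preim uq xq).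
apply: filterS2 h1 (near_img (chart_img_phi uq)) => z' hz [q' uq' ez].
by move: hz; rewrite -ez chart_psiK // => -[_ xq']; exists q'.
Qed.

Lemma local_map_diff (u q : L) (x : M) : dom u q -> dom x (p q) ->
  differentiable (local_map u x) (phi u q).
Proof.
by move=> uq xq; apply: smooth_on_differentiable (@local_map_smooth u x) _; exists q.
Qed.

(** Chain rule: both sides are the differential at [phi u q] of [p] read in the charts at [u] and at
    [p q], factored through the chart at [q] on the left and through the chart at [x] on the
    right. *)
Lemma tangent_map_chg (u q : L) (x : M) v : dom u q -> dom x (p q) ->
  tangent_map p q (chg u q q v) =
  chg x (p q) (p q) ('d (local_map u x) (phi u q) v).
Proof.
move=> uq xq; have qq := man_chart_dom q; have pp := man_chart_dom (p q).
have d1 := transition_differentiable uq qq.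
have d2 : differentiable (local_map q (p q)) ((phi q \o psi u) (phi u q)).
  by rewrite /= chart_psiK //; exact: local_map_diff.
have d3 := local_map_diff uq xq.
have d4 : differentiable (phi (p q) \o psi x) (local_map u x (phi u q)).
  by rewrite /local_map /= chart_psiK //; exact: transition_differentiable.
have e1 : (phi q \o psi u) (phi u q) = phi q q by rewrite /= chart_psiK.
have e2 : local_map u x (phi u q) = phi x (p q).
  by rewrite /local_map /= chart_psiK.
have E1 w : tangent_map p q w =
    'd (local_map q (p q)) ((phi q \o psi u) (phi u q)) w.
  by rewrite e1.
have E2 w : chg x (p q) (p q) w =
    'd (phi (p q) \o psi x) (local_map u x (phi u q)) w.
  by rewrite e2.
apply: etrans (E1 _) _; apply: etrans _ (esym (E2 _)).
apply: etrans (esym (congr1 (fun f => f v) (diff_comp d1 d2))) _.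
apply: etrans _ (congr1 (fun f => f v) (diff_comp d3 d4)).
apply: near_eq_diff; [|exact: differentiable_comp|exact: differentiable_comp].
have h1 := near_psi uq (near_dom_preim qq pp).
have h2 := near_psi uq (near_dom_preim uq xq).
apply: filterS2 h1 h2 => z [qz _] [_ xz].
by rewrite /local_map /= !chart_psiK.
Qed.

(** The charts at [q] and [p q] depend on [q] without any continuity; here the pullback is rewritten
    in the fixed charts at [u] and [x], where smoothness can be used. *)
Lemma pullback_loc_form k (w : dform R M k) (u q : L) (x : M) v :
  dom u q -> dom x (p q) ->
  w (p q) (fun i => tangent_map p q (chg u q q (v i))) =
  loc_form w x (local_map u x (phi u q))
    (fun i => 'd (local_map u x) (phi u q) (v i)).
Proof.
move=> uq xq; rewrite /loc_form /local_map /= !chart_psiK //; congr (w _ _).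
by apply/funext => i; rewrite (tangent_map_chg _ uq xq).
Qed.

Lemma pullback_form_continuous k (w : dform R M k) (u : L) (v : 'I_k -> 'rV[R]_n) :
  is_form w ->
  {for u, continuous (fun q =>
    w (p q) (fun i => tangent_map p q (chg u q q (v i))))}.
Proof.
move=> wf; pose x := p u; have uu := man_chart_dom u.
have xx : dom x (p u) by exact: man_chart_dom.
pose F := local_map u x.
pose B z := loc_form w x (F z).
have H : {for phi u u, continuous (fun z => B z (fun i => 'd F z (v i)))}.
  have Uz : local_dom u x (phi u u) by exists u.
  have := @alternating_continuous R n m k (phi u u) B (fun i => 'D_(v i) F).
  have -> : {for phi u u, continuous (fun z => B z (fun i => 'd F z (v i)))} <->
     {for phi u u, continuous (fun z => B z (fun i => 'D_(v i) F z))}.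
    have nE : \forall z \near phi u u,
        B z (fun i => 'd F z (v i)) = B z (fun i => 'D_(v i) F z).
      apply: filterS (open_nbhs_nbhs (conj (@local_dom_open u x) Uz)) => z Uz'.
      congr (B z _); apply/funext => i; rewrite deriveE //.
      exact: smooth_on_differentiable (@local_map_smooth u x) Uz'.
    split; apply: near_eq_continuous => //.
    by apply: filterS nE => z ->.
  apply.
  - by move=> z; exact: loc_form_alternating.
  - move=> v'; apply: (@continuous_comp _ _ _ F (fun y => loc_form w x y v')).
      exact: smooth_on_continuous (@local_map_smooth u x) Uz.
    have [_ ws] := wf; apply: smooth_on_continuous (ws x v') _.
    by rewrite /F /local_map /= chart_psiK //; exact: chart_img_phi.
  - move=> i; apply: (smooth_on_continuous _ Uz).
    exact/smooth_on_derive/local_map_smooth.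
have cphi : {for u, continuous (phi u)}.
  exact: (chart_map_cont (man_chart u) uu).
apply: near_eq_continuous (continuous_comp cphi H).
apply: filterS (near_dom_preim uu xx) => q [uq xq].
by apply: esym; exact: pullback_loc_form.
Qed.

Lemma pullback0_closed (w : dform R M 1) : is_form w ->
  (forall u v, pullback p w u v = 0) ->
  forall u v1 v2, ext w (p u) (two (tangent_map p u v1) (tangent_map p u v2)) = 0.
Proof.
move=> wf pw u v w'; pose x := p u; have uu := man_chart_dom u.
have xx : dom x (p u) by exact: man_chart_dom.
pose F := local_map u x; pose z := phi u u.
have Uz : local_dom u x z by exists u.
have Fz : F z = phi x x by rewrite /F /local_map /= chart_psiK.
(* The components of [w] in the chart at [x], which bring the claim to the form of
   [pullback1_closed]. *)
pose a (j : 'I_m) (y : 'rV[R]_m) := loc_form w x y (fun=> delta_mx 0 j).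
have aE y (V : 'I_1 -> 'rV[R]_m) : loc_form w x y V =
    \sum_j (V ord0) ord0 j * a j y.
  have lA := loc_form_alternating x y wf.
  have -> : loc_form w x y V =
      loc_form w x y (upd V ord0 (\sum_j (V ord0) ord0 j *: delta_mx 0 j)).
    by rewrite -row_sum_delta upd_id.
  rewrite alt_sum //; apply: eq_bigr => j _; rewrite altZ //.
  congr (_ * loc_form _ _ _ _); apply/funext => i.
  by rewrite (ord1 i) updE.
have da j : differentiable (a j) (F z).
  have [_ ws] := wf; apply: smooth_on_differentiable (ws x _) _.
  by rewrite Fz; exact: chart_img_phi.
have a0 z' V : local_dom u x z' -> \sum_j ('D_V F z') ord0 j * a j (F z') = 0.
  move=> Uz'; have dF := smooth_on_differentiable (@local_map_smooth u x) Uz'.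
  case: Uz' dF => q [uq xq] <- dF.
  rewrite (deriveE _ dF) -(aE _ (fun=> 'd F (phi u q) V)) -pullback_loc_form //.
  exact: pw.
have key := pullback1_closed (@local_dom_open u x) (@local_map_smooth u x) Uz
  da a0 v w'.
have dF := smooth_on_differentiable (@local_map_smooth u x) Uz.
have DE V1 V2 : 'D_V1 (fun y => loc_form w x y (fun=> V2)) (F z) =
    \sum_j V2 ord0 j * 'D_V1 (a j) (F z).
  have -> : (fun y => loc_form w x y (fun=> V2)) = \sum_j (V2 ord0 j *: a j).
    by apply/funext => y; rewrite aE fct_sumE.
  have hd j : is_derive (F z) V1 (V2 ord0 j *: a j) (V2 ord0 j *: 'D_V1 (a j) (F z)).
    have dj := derivableP (@diff_derivable _ _ _ (a j) (F z) V1 (da j)).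
    exact: (@is_deriveZ _ _ _ (a j) (V2 ord0 j) (F z) V1 _ dj).
  by have [_] := is_derive_sum hd.
rewrite ext_two -/x -Fz.
have T V : tangent_map p u V = 'D_V F z by rewrite deriveE.
rewrite !T.
apply/eqP; rewrite subr_eq0; apply/eqP.
apply: etrans (DE _ _) _; apply: etrans _ (esym (DE _ _)).
exact: key.
Qed.

End Pullback.

End ChartCalculus.

(** * Pointwise geometry of a contact Calabi-Yau manifold *)

Section ExtOneForm.
Context {R : realType} {m : nat} {M : manifold R m}.
Variables (w : dform R M 1) (x : M).
Hypothesis wf : is_form w.

Lemma loc_form1L y c (u v : 'rV[R]_m) :
  loc_form w x y (fun=> c *: u + v) =
  c * loc_form w x y (fun=> u) + loc_form w x y (fun=> v).
Proof.
have [lL _] := loc_form_alternating x y wf.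
have E z : (fun=> z) = upd (fun=> 0 : 'rV[R]_m) (ord0 : 'I_1) z.
  by apply/funext => i; rewrite (ord1 i) updE.
by rewrite (E (c *: u + v)) (E u) (E v) lL.
Qed.

Lemma ext_twoC u v : ext w x (two u v) = - ext w x (two v u).
Proof.
apply: etrans (ext_two w x u v) _.
by apply: etrans _ (congr1 -%R (esym (ext_two w x v u))); rewrite opprB.
Qed.

Lemma ext_twoL c u v z : ext w x (two (c *: u + v) z) =
  c * ext w x (two u z) + ext w x (two v z).
Proof.
set pt := chart_map (chart_at x) x.
have dw V : differentiable (fun y => loc_form w x y (fun=> V)) pt.
  have [_ ws] := wf; apply: smooth_on_differentiable (ws x (fun=> V)) _.
  exact/chart_img_phi/man_chart_dom.
have e1 V : 'D_(c *: u + v) (fun y => loc_form w x y (fun=> V)) pt =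
    c * 'D_u (fun y => loc_form w x y (fun=> V)) pt
    + 'D_v (fun y => loc_form w x y (fun=> V)) pt.
  apply: etrans (deriveE _ (dw V)) _; rewrite linearP.
  by congr (_ * _ + _); apply: esym; exact: deriveE.
have e2 V : 'D_V (fun y => loc_form w x y (fun=> c *: u + v)) pt =
    c * 'D_V (fun y => loc_form w x y (fun=> u)) pt
    + 'D_V (fun y => loc_form w x y (fun=> v)) pt.
  have -> : (fun y => loc_form w x y (fun=> c *: u + v)) =
     c *: (fun y => loc_form w x y (fun=> u)) + (fun y => loc_form w x y (fun=> v)).
    by apply/funext => y; rewrite loc_form1L.
  have du := @diff_derivable _ _ _ _ _ V (dw u).
  have dv := @diff_derivable _ _ _ _ _ V (dw v).
  have [_ e] := @is_deriveD _ _ _ _ _ _ _ _ _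
    (@is_deriveZ _ _ _ _ c _ _ _ (derivableP du)) (derivableP dv).
  exact: e.
apply: etrans (ext_two w x (c *: u + v) z) _.
apply: etrans (congr2 (fun a b => a - b) (e1 z) (e2 z)) _.
apply: etrans _ (congr2 (fun a b => c * a + b)
  (esym (ext_two w x u z)) (esym (ext_two w x v z))).
have key (a b a' b' : R) :
    (c * a + b) - (c * a' + b') = c * (a - a') + (b - b') by ring.
exact: key.
Qed.

End ExtOneForm.

(** Each slot contributes a multiple of a value having [r] among its arguments, which is zero. *)
Lemma alternating_shift {R : realType} {m k : nat} (a : ('I_k -> 'rV[R]_m) -> R)
    (r : 'rV[R]_m) (v : 'I_k -> 'rV[R]_m) (c : 'I_k -> R) :
  alternating a -> (forall v i, v i = r -> a v = 0) ->
  a (fun i => v i - c i *: r) = a v.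
Proof.
move=> aA a0.
have H l : (l <= k)%N ->
    a (fun i : 'I_k => if (i < l)%N then v i - c i *: r else v i) = a v; last first.
  rewrite -(H k (leqnn k)); congr a; apply/funext => i.
  by rewrite ltn_ord.
elim: l => [//|l IH lk]; rewrite -(IH (ltnW lk)); pose i0 := Ordinal lk.
set y := fun i : 'I_k => if (i < l)%N then _ else _.
have -> : (fun i : 'I_k => if (i < l.+1)%N then v i - c i *: r else v i) =
    upd y i0 (y i0 + (- c i0) *: r).
  apply/funext => i; rewrite /y /upd; have [->|ii0] := eqVneq i i0.
    by rewrite /= ltnSn ltnn scaleNr.
  rewrite ltnS leq_eqVlt; case: eqP => //= e.
  by case/eqP: ii0; apply/val_inj.
rewrite altD // upd_id altZ // (a0 (upd y i0 r) i0) ?updE //.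
by rewrite mulr0 addr0.
Qed.

Section ContactPoint.
Context {R : realType} {n : nat} {M : manifold R n.*2.+1}.
Variables (alpha : dform R M 1) (Rv : vfield M) (J : endo M) (eps : dform R[i]%C M n).
Hypothesis hCY : contact_CY alpha Rv J eps.
Variable x : M.
Local Notation V := 'rV[R]_(n.*2.+1).
Local Notation S := (xi alpha x).
Local Notation g := (g_J alpha J x).
Local Notation kap u v := (kappa alpha x (two u v)).

Let sas := cy_sasakian hCY.
Let alphaF : is_form alpha := contact_is_form (sas_contact sas).
Let reeb := sas_reeb sas.
Let cs := sas_J sas.
Let cal := sas_calibrated sas.
Let lam := cy_type hCY.

Lemma kapL c (u v z : V) : kap (c *: u + v) z = c * kap u z + kap v z.
Proof. by rewrite /kappa ext_twoL // mulrDr mulrCA. Qed.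

Lemma kapC (u v : V) : kap u v = - kap v u.
Proof. by rewrite /kappa ext_twoC mulrN. Qed.

Lemma kapR c (u v z : V) : kap z (c *: u + v) = c * kap z u + kap z v.
Proof. by rewrite !(kapC z) kapL opprD mulrN. Qed.

Lemma kap_reeb (v : V) : kap (Rv x) v = 0.
Proof. by rewrite /kappa (reeb_dalpha reeb (i := ord0)) ?mulr0. Qed.

Lemma ev1L c (u v : V) :
  ev1 alpha x (c *: u + v) = c * ev1 alpha x u + ev1 alpha x v.
Proof.
have [/(_ x) [aL _] _] := alphaF; rewrite /ev1.
have E z : (fun=> z) = upd (fun=> 0 : V) (ord0 : 'I_1) z.
  by apply/funext => i; rewrite (ord1 i) updE.
by rewrite (E (c *: u + v)) (E u) (E v) aL.
Qed.

Lemma xi0 : S 0.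
Proof.
have := ev1L (-1) 0 0; rewrite scaler0 addr0 mulN1r addNr.
by rewrite /xi /=.
Qed.

Lemma xiL c u v : S u -> S v -> S (c *: u + v).
Proof. by rewrite /xi /= ev1L => -> ->; rewrite mulr0 addr0. Qed.

Lemma gL c (u v z : V) : g (c *: u + v) z = c * g u z + g v z.
Proof. exact: kapL. Qed.

Lemma gR c (u v z : V) : g z (c *: u + v) = c * g z u + g z v.
Proof. by rewrite /g_J (cs_linear cs) kapR. Qed.

Lemma gJ_skew u v : S u -> S v -> g (J x u) v = - g u (J x v).
Proof.
move=> Su Sv; rewrite -(cal_herm cal (cs_xi cs Su) Sv) (cs_sqr cs Su).
have := gL (-1) u 0 (J x v); rewrite scaleN1r addr0 mulN1r => ->.
by rewrite (form0l gL) addr0.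
Qed.

Lemma gJJ u v : S u -> S v -> g u v = 0 -> g (J x u) (J x v) = 0.
Proof. by move=> Su Sv <-; exact: (cal_herm cal). Qed.

Lemma kap_g u v : S v -> kap u v = - g u (J x v).
Proof.
move=> Sv; rewrite /g_J (cs_sqr cs Sv).
have := kapR (-1) v 0 u; rewrite scaleN1r addr0 mulN1r => ->.
have := kapR (-1) 0 0 u; rewrite scaler0 addr0 mulN1r addNr => ->.
by rewrite addr0 opprK.
Qed.

Let reA : alternating (fun v => complex.Re (eps x v)).
Proof. by have [[+ _] _] := Lambda_form lam; apply. Qed.

Let imA : alternating (fun v => complex.Im (eps x v)).
Proof. by have [_ [+ _]] := Lambda_form lam; apply. Qed.

Let typeE (X : 'I_n -> V) (t : {ffun 'I_n -> bool}) :
  (forall j, S (X j)) -> #|[set j | t j]%SET| <> n ->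
  complexified (eps x) X (fun j => if t j then - J x (X j) else J x (X j)) = 0.
Proof. by have [_] := Lambda_type lam; apply. Qed.

Lemma eps_orth_norm_sq (y : 'I_n -> V) : (forall i, S (y i)) ->
  (forall i j, i != j -> g (y i) (y j) = 0 /\ g (y i) (J x (y j)) = 0) ->
  complex.Re (eps x y) ^+ 2 + complex.Im (eps x y) ^+ 2 = \prod_i g (y i) (y i).
Proof.
move=> Sy oy.
have SJ v : S v -> S (J x v) by exact: (cs_xi cs).
have JJ0 v : S v -> g v (J x v) = 0.
  by move=> Sv; exact: (form_JJ0 SJ (cal_sym cal (x:=x)) gJ_skew).
have gd i j : g (y i) (y j) = g (y i) (y i) *+ (i == j).
  by have [->|/oy[]] := eqVneq i j.
have gJd i j : g (y i) (J x (y j)) = 0.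
  by have [->|/oy[]] := eqVneq i j; [exact: JJ0|].
apply: (orth_norm_sq reA imA typeE Sy (a := kappa alpha x)).
- exact: (cy_volume hCY).
- by move=> i j; rewrite kap_g // gJd oppr0.
- move=> i j; rewrite -[LHS]/(g (J x (y i)) (y j)) gJ_skew //.
  by rewrite gJd oppr0.
- by move=> i j; exact: gd.
- by move=> i j; rewrite kapC -[kap _ _]/(g (y j) (y i)) gd eq_sym;
    have [->|] := eqVneq i j; rewrite ?mulr1n // !mulr0n oppr0.
- by move=> i; exact: (form_ge0 gL (cal_pos cal (x:=x))).
Qed.

Lemma eps_hadamard (X : 'I_n -> V) : (forall i, S (X i)) ->
  complex.Re (eps x X) ^+ 2 + complex.Im (eps x X) ^+ 2 <= \prod_i g (X i) (X i).
Proof.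
move=> SX.
have SJ v : S v -> S (J x v) by exact: (cs_xi cs).
have fE (y : 'I_n -> V) k (a b : 'I_n -> R) : (forall i, S (y i)) ->
    eps x (upd y k (y k - \sum_(j | j != k) (a j *: y j + b j *: J x (y j)))) =
    eps x y.
  move=> Sy.
  have e0 j : j != k -> eps x (upd y k (y j)) = 0.
    move=> jk; have ykj : upd y k (y j) k = upd y k (y j) j.
      by rewrite updE updN.
    have kj : k != j by rewrite eq_sym.
    have [_ /(_ _ _ _ kj ykj) r0] := reA; have [_ /(_ _ _ _ kj ykj) i0] := imA.
    by move: r0 i0; case: (eps x _) => /= ? ? -> ->.
  (* By [top_type], applying [J] in slot [k] alone multiplies the value by i, and the value with
     [y j] in slot [k] is zero because [y j] occurs twice. *)
  have eJ0 j : j != k -> eps x (upd y k (J x (y j))) = 0.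
    move=> jk.
    have SX' i : S (upd y k (y j) i) by rewrite /upd; case: eqP.
    have := top_type reA imA typeE (fun i => i == k) SX'.
    rewrite e0 // mulr0 => <-; congr (eps x _); apply/funext => i.
    by rewrite /upd; case: eqP.
  have shift (a' : ('I_n -> V) -> R) : alternating a' ->
      (forall j, j != k -> a' (upd y k (y j)) = 0) ->
      (forall j, j != k -> a' (upd y k (J x (y j))) = 0) ->
      a' (upd y k (y k - \sum_(j | j != k) (a j *: y j + b j *: J x (y j)))) = a' y.
    move=> aA z1 z2; rewrite -sumrN altD // upd_id alt_sum // big1 ?addr0 //.
    move=> j jk; rewrite -scaleN1r altZ // altD // !altZ // z1 // z2 //.
    by rewrite !mulr0 addr0 mulr0.
  have r := shift _ reA (fun j jk => congr1 (@complex.Re R) (e0 j jk))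
    (fun j jk => congr1 (@complex.Re R) (eJ0 j jk)).
  have i := shift _ imA (fun j jk => congr1 (@complex.Im R) (e0 j jk))
    (fun j jk => congr1 (@complex.Im R) (eJ0 j jk)).
  by apply/eqP; rewrite eq_complex r i !eqxx.
have [y [Sy <- oy ly]] := gram_schmidt xi0 xiL SJ gL gR (cal_sym cal (x:=x))
  (cal_pos cal (x:=x)) gJ_skew gJJ fE SX.
rewrite eps_orth_norm_sq //; apply: ler_prod => i _; rewrite ly andbT.
exact: (form_ge0 gL (cal_pos cal (x:=x))).
Qed.

Definition xi_proj (v : V) : V := v - ev1 alpha x v *: Rv x.

Lemma xi_projP v : S (xi_proj v).
Proof.
rewrite /xi_proj /xi /= addrC -scaleNr ev1L (reeb_alpha reeb) mulr1.
by rewrite addNr.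
Qed.

Lemma xi_proj_id v : S v -> xi_proj v = v.
Proof. by rewrite /xi_proj /xi /= => ->; rewrite scale0r subr0. Qed.

Lemma eps_proj (v : 'I_n -> V) : eps x (fun i => xi_proj (v i)) = eps x v.
Proof.
have [[r0 _] [i0 _]] := Lambda_basic lam.
have r := alternating_shift v (fun i => ev1 alpha x (v i)) reA (r0 x).
have i := alternating_shift v (fun i => ev1 alpha x (v i)) imA (i0 x).
by apply/eqP; rewrite eq_complex r i !eqxx.
Qed.

Lemma metric_proj u v : metric alpha J x u v =
  g (xi_proj u) (xi_proj v) + ev1 alpha x u * ev1 alpha x v.
Proof.
rewrite /metric; congr (_ + _); rewrite /g_J.
have -> : J x (xi_proj v) = J x v.
  rewrite /xi_proj addrC -scaleNr (cs_linear cs) (cs_reeb cs).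
  by rewrite scaler0 add0r.
by rewrite /xi_proj addrC -scaleNr kapL kap_reeb mulr0 add0r.
Qed.

Lemma metric_xi u v : S u -> S v -> metric alpha J x u v = g u v.
Proof.
by move=> Su Sv; rewrite /metric; move: Su; rewrite /xi /= => ->; rewrite mul0r addr0.
Qed.

Lemma metricL c u v z : metric alpha J x (c *: u + v) z =
  c * metric alpha J x u z + metric alpha J x v z.
Proof. by rewrite /metric gL ev1L; ring. Qed.

Lemma metricC u v : metric alpha J x u v = metric alpha J x v u.
Proof.
rewrite (metric_proj u v) (metric_proj v u) [ev1 _ _ v * _]mulrC.
by rewrite (cal_sym cal (xi_projP u) (xi_projP v)).
Qed.

Lemma metric_gt0 v : v != 0 -> 0 < metric alpha J x v v.
Proof.
move=> v0; rewrite metric_proj -expr2.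
have [e|e] := eqVneq (ev1 alpha x v) 0.
  rewrite e expr0n addr0 xi_proj_id //; exact: (cal_pos cal).
rewrite ltr_wpDl ?exprn_even_gt0 ?e ?orbT //.
exact: (form_ge0 gL (cal_pos cal (x:=x)) (xi_projP v)).
Qed.

End ContactPoint.

(** * Orthogonal frames and Gram determinants *)

Lemma det_delta_rows (R : comNzRingType) (n : nat) :
  \det (\matrix_i (delta_mx 0 i : 'rV[R]_n)) = 1.
Proof.
rewrite -[RHS](det1 R n); congr (\det _); apply/matrixP => i j.
by rewrite !mxE eqxx eq_sym.
Qed.

(** Gram-Schmidt without normalisation, started from the standard basis, keeps the determinant [D]
    equal to 1. Hence the Gram determinant is that of the diagonal matrix Y H Y^T. *)
Lemma real_orthogonal_frame (R : realType) (n : nat)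
    (h : 'rV[R]_n -> 'rV[R]_n -> R) :
  (forall c u v z, h (c *: u + v) z = c * h u z + h v z) ->
  (forall u v, h u v = h v u) -> (forall v, v != 0 -> 0 < h v v) ->
  exists y : 'I_n -> 'rV[R]_n, [/\ \det (\matrix_i y i) = 1,
    forall i j, i != j -> h (y i) (y j) = 0 &
    \det (\matrix_(i < n, j < n) h (delta_mx 0 i) (delta_mx 0 j)) =
      \prod_i h (y i) (y i)].
Proof.
move=> hL hC hpos.
have hR c u v z : h z (c *: u + v) = c * h z u + h z v by rewrite !(hC z) hL.
pose D (v : 'I_n -> 'rV[R]_n) := \det (\matrix_i v i).
have DA := @det_alternating R n; rewrite -/D in DA.
have fE (y : 'I_n -> 'rV[R]_n) k (a b : 'I_n -> R) : (forall i, setT (y i)) ->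
    D (upd y k (y k - \sum_(j | j != k) (a j *: y j + b j *: 0))) = D y.
  move=> _; rewrite -sumrN altD // upd_id alt_sum // big1 ?addr0 // => j jk.
  rewrite scaler0 addr0 -scaleN1r altZ // altZ //.
  have [_ D0] := DA; rewrite (D0 _ k j) ?mulr0 //; first by rewrite eq_sym.
  by rewrite updE updN.
have [||||||||y [_ Dy oy _]] := @gram_schmidt R _ setT (fun=> 0) h _ _ _ hL hR _ _ _ _
    n _ D fE (fun i => delta_mx 0 i).
- by [].
- by [].
- by [].
- by move=> *; exact: hC.
- by move=> v _; exact: hpos.
- by move=> u v _ _; rewrite (form0l hL) (form0r hR) oppr0.
- by move=> u v _ _ _; exact: (form0l hL).
- by [].
exists y.
have D1 : D (fun i : 'I_n => delta_mx 0 i) = 1 by exact: det_delta_rows.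
split; [by rewrite -D1|by move=> i j /oy[]|].
pose Y := \matrix_i y i.
pose H := \matrix_(i < n, j < n) h (delta_mx 0 i) (delta_mx 0 j).
have hsum (u z : 'rV[R]_n) : h u z = \sum_j u ord0 j * h (delta_mx 0 j) z.
  rewrite {1}[u]row_sum_delta (form_suml hL); apply: eq_bigr => j _.
  exact: formZl.
have e : Y *m H *m Y^T = diag_mx (\row_i h (y i) (y i)).
  apply/matrixP => i j; rewrite !mxE.
  transitivity (h (y i) (y j)).
    rewrite hC hsum; apply: eq_bigr => k _; rewrite !mxE mulrC; congr (_ * _).
    rewrite hC hsum; apply: eq_bigr => l _.
    by rewrite !mxE.
  by have [->|/oy[-> _]] := eqVneq i j.
have := congr1 determinant e.
have -> : \det (diag_mx (\row_i h (y i) (y i))) = \prod_i h (y i) (y i).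
  by rewrite det_diag; apply: eq_bigr => i _; rewrite mxE.
move=> <-; rewrite !det_mulmx det_tr.
have -> : \det Y = 1 by rewrite -D1 -Dy.
by rewrite mul1r mulr1.
Qed.

(** If [b i] were positive, raising the factor [a i] to [a i + b i] would increase the product
    strictly, since the other factors [a j + b j] are positive. *)
Lemma prod_add_le_eq (R : realDomainType) (n : nat) (a b : 'I_n -> R) :
  (forall i, 0 <= a i) -> (forall i, 0 <= b i) -> (forall i, 0 < a i + b i) ->
  \prod_i (a i + b i) <= \prod_i a i -> forall i, b i = 0.
Proof.
move=> a0 b0 ab0 le_ab i; apply/eqP; rewrite eq_le b0 andbT leNgt.
apply/negP => bi; move: le_ab; rewrite leNgt => /negP; apply.
rewrite (bigD1 i) //= [X in _ < X](bigD1 i) //=.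
apply: (@le_lt_trans _ _ (a i * \prod_(j | j != i) (a j + b j))).
  rewrite ler_wpM2l //; apply: ler_prod => j _.
  by rewrite a0 lerDl b0.
by rewrite ltr_pM2r ?ltrDl // prodr_gt0.
Qed.

(** * The tangent space of the submanifold at one point *)

Section LegendrianPoint.
Context {R : realType} {n : nat} {M : manifold R n.*2.+1}.
Variables (alpha : dform R M 1) (Rv : vfield M) (J : endo M) (eps : dform R[i]%C M n).
Hypothesis hCY : contact_CY alpha Rv J eps.
Context {L : manifold R n} {p : L -> M}.
Hypothesis hp : submanifold p.
Variable u : L.

Local Notation x := (p u).
Local Notation T := (tangent_map p u).
Local Notation h := (induced_metric p (metric alpha J) u).
Local Notation std := (fun i : 'I_n => delta_mx 0 i : 'rV[R]_n).

Lemma tangent_mapL c (v w : 'rV[R]_n) : T (c *: v + w) = c *: T v + T w.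
Proof. by rewrite /tangent_map linearP. Qed.

Lemma tangent_map_neq0 v : v != 0 -> T v != 0.
Proof.
apply: contraNneq => Tv; apply/eqP/(sub_immersion hp (u := u)).
by rewrite Tv /tangent_map linear0.
Qed.

Lemma pullback_top (a : ('I_n -> 'rV[R]_(n.*2.+1)) -> R) (v : 'I_n -> 'rV[R]_n) :
  alternating a -> a (T \o v) = \det (\matrix_i v i) * a (T \o std).
Proof.
move=> aA; rewrite -alt_det //; congr a; apply/funext => i /=.
rewrite {1}[v i]row_sum_delta /tangent_map linear_sum; apply: eq_bigr => j _.
by rewrite linearZ mxE.
Qed.

Let reA : alternating (fun v => Re_form eps x v).
Proof. by have [[+ _] _] := Lambda_form (cy_type hCY); apply. Qed.

Let imA : alternating (fun v => Im_form eps x v).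
Proof. by have [_ [+ _]] := Lambda_form (cy_type hCY); apply. Qed.

(** As the frame has determinant 1, a form of degree n takes the same value on it as on the
    coordinate frame. Positivity of the lengths comes from the immersion. *)
Lemma induced_frame : exists y : 'I_n -> 'rV[R]_n,
  [/\ \det (\matrix_i y i) = 1,
    forall i j, i != j -> metric alpha J x (T (y i)) (T (y j)) = 0,
    \det (\matrix_(i < n, j < n) h (delta_mx 0 i) (delta_mx 0 j)) =
      \prod_i metric alpha J x (T (y i)) (T (y i)) &
    forall i, 0 < metric alpha J x (T (y i)) (T (y i))].
Proof.
have hpos v : v != 0 -> 0 < h v v.
  by move=> v0; apply: (metric_gt0 hCY); exact: tangent_map_neq0.
have [||y [y1 oy dy]] := @real_orthogonal_frame R n h _ _ hpos.
- by move=> c v w z; rewrite /induced_metric tangent_mapL (metricL hCY).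
- by move=> v w; exact: (metricC hCY).
exists y; split => // i; apply: hpos; apply/eqP => yi.
have : \det (\matrix_i y i) = 0.
  rewrite (expand_det_row _ i) big1 // => j _.
  by rewrite !mxE yi mxE mul0r.
by rewrite y1 => /eqP; rewrite oner_eq0.
Qed.

Lemma legendrian_norm_sq : (forall u v, pullback p alpha u v = 0) ->
  Re_form eps x (T \o std) ^+ 2 + Im_form eps x (T \o std) ^+ 2 =
  \det (\matrix_(i < n, j < n) h (delta_mx 0 i) (delta_mx 0 j)).
Proof.
move=> pa; have [y [y1 oy -> _]] := induced_frame.
have af := contact_is_form (sas_contact (cy_sasakian hCY)).
have Sy v : xi alpha x (T v).
  by rewrite /xi /= /ev1; exact: (pa u (fun=> v)).
have -> : Re_form eps x (T \o std) = Re_form eps x (T \o y).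
  by rewrite (pullback_top y) // y1 mul1r.
have -> : Im_form eps x (T \o std) = Im_form eps x (T \o y).
  by rewrite (pullback_top y) // y1 mul1r.
rewrite (eps_orth_norm_sq hCY (y := T \o y)); first last.
- move=> i j ij; split.
    by apply: etrans (esym (metric_xi _ _ _)) (oy i j ij); exact: Sy.
  (* Up to sign this is [kappa] on two tangent vectors, half the differential of a form whose
     pullback is zero. *)
  apply/eqP; rewrite -oppr_eq0 -(kap_g hCY _ (Sy (y j))) /kappa.
  by rewrite (pullback0_closed (sub_smooth hp)) ?mulr0.
- by move=> i; exact: Sy.
by apply: eq_bigr => i _; apply: esym; apply: metric_xi; exact: Sy.
Qed.

Lemma calibrated_point :
  Re_form eps x (T \o std) ^+ 2 =
    \det (\matrix_(i < n, j < n) h (delta_mx 0 i) (delta_mx 0 j)) ->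
  (forall v, ev1 alpha x (T v) = 0) /\ (forall v, Im_form eps x (T \o v) = 0).
Proof.
have [y [y1 oy -> y0]] := induced_frame.
set A := fun v => ev1 alpha x v.
have reE : Re_form eps x (T \o std) = Re_form eps x (T \o y).
  by rewrite (pullback_top y) // y1 mul1r.
have imE : Im_form eps x (T \o std) = Im_form eps x (T \o y).
  by rewrite (pullback_top y) // y1 mul1r.
rewrite reE => re2.
pose z i := xi_proj alpha Rv x (T (y i)).
have Sz i : xi alpha x (z i) by exact: (xi_projP hCY).
have gz0 i : 0 <= g_J alpha J x (z i) (z i).
  have cal := sas_calibrated (cy_sasakian hCY).
  by exact: (form_ge0 (gL hCY x) (cal_pos cal (x:=x))).
have mE i : metric alpha J x (T (y i)) (T (y i)) =
    g_J alpha J x (z i) (z i) + A (T (y i)) ^+ 2.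
  by rewrite (metric_proj hCY) expr2.
have had := eps_hadamard hCY Sz.
have hz : eps x z = eps x (T \o y) := eps_proj hCY x (T \o y).
rewrite hz -/(Re_form eps x _) -/(Im_form eps x _) re2 in had.
have prodle : \prod_i (g_J alpha J x (z i) (z i) + A (T (y i)) ^+ 2) <=
    \prod_i g_J alpha J x (z i) (z i).
  under eq_bigr do rewrite -mE.
  by apply: le_trans had; rewrite lerDl sqr_ge0.
have A0 := prod_add_le_eq gz0 (fun i => sqr_ge0 (A (T (y i))))
  (fun i => (eq_ind _ (fun t => is_true (0 < t)) (y0 i) _ (mE i))) prodle.
have im0 : Im_form eps x (T \o std) = 0.
  (* Once projected lengths are replaced by full ones, Hadamard's bound says that the square of the
     real part plus that of the imaginary part is at most the former alone. *)
  rewrite imE; apply/eqP; rewrite -sqrf_eq0 eq_le sqr_ge0 andbT.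
  rewrite -(lerD2l (\prod_i metric alpha J x (T (y i)) (T (y i)))) addr0.
  apply: le_trans had _; apply: ler_prod => i _.
  by rewrite gz0 mE lerDl sqr_ge0.
split=> [v|v]; last by rewrite pullback_top // im0 mulr0.
(* The frame has determinant 1, hence is a basis, which carries the vanishing of [alpha] from the
   frame to the whole tangent space. *)
have Yu : \matrix_i y i \in unitmx by rewrite unitmxE y1 unitr1.
have AL c v1 v2 : A (c *: v1 + v2) = c * A v1 + A v2 by exact: (ev1L hCY).
have A00 : A 0 = 0.
  by have := AL (-1) 0 0; rewrite scaler0 addr0 mulN1r addNr.
have key (c : 'I_n -> R) : A (T (\sum_i c i *: row i (\matrix_i y i))) = 0.
  elim/big_rec: _ => [|i w _ IH]; first by rewrite /tangent_map linear0.
  rewrite tangent_mapL AL IH addr0 rowK.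
  by apply/eqP; rewrite mulf_eq0 -[X in _ || X]sqrf_eq0 A0 eqxx orbT.
by rewrite -[v](mulmxKV Yu) mulmx_sum_row; exact: key.
Qed.

End LegendrianPoint.

(** * Orientation by the sign of a form, and the equivalence *)

(** The value [r q] on the coordinate frame of [chart_at q] can jump with the chart. The frame of
    the fixed chart at [u], transported to [q], gives instead a continuous function [f], equal to
    [r] times the transition determinant. Since [f u] is nonzero, the sign of [f] is constant near
    [u]. *)
Lemma frame_sign_orientation (R : realType) (n m : nat) (L : manifold R n)
    (M : manifold R m) (p : L -> M) (w : dform R M n) :
  smooth_map p -> is_form w ->
  (forall u, w (p u) (fun i => tangent_map p u (delta_mx 0 i)) != 0) ->
  orientation (fun u => w (p u) (fun i => tangent_map p u (delta_mx 0 i)) < 0).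
Proof.
move=> ps wf w0 u.
pose r q := w (p q) (fun i => tangent_map p q (delta_mx 0 i)).
pose f q := w (p q) (fun i => tangent_map p q (chg u q q (delta_mx 0 i))).
have fE q : f q = \det (lin1_mx (chg u q q)) * r q.
  have wA : alternating (fun v => w (p q) (fun i => tangent_map p q (v i))).
    have [/(_ (p q)) wA _] := wf.
    exact: (alternating_linear_comp
      ('d (chart_map (chart_at (p q)) \o p \o chart_inv (chart_at q))
          (chart_map (chart_at q) q)) wA).
  rewrite /r -(alt_det wA) /f; congr (w (p q)); apply/funext => i.
  congr (tangent_map p q); rewrite [LHS]row_sum_delta.
  by apply: eq_bigr => j _; rewrite !mxE.
have fu : f u = r u.
  rewrite /f /r; congr (w (p u)); apply/funext => i.
  by rewrite chg_id //; exact: man_chart_dom.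
have cf : {for u, continuous f} by exact: pullback_form_continuous.
have r0 q : r q != 0 by exact: w0.
suff : \forall q \near u,
    (-1) ^+ (r q < 0)%R * Num.sg (\det (lin1_mx (chg u q q))) =
    (-1) ^+ (r u < 0)%R :> R by [].
(* [r] and [f] are made opaque: otherwise rewriting compares frame values at
   different points by unfolding them. *)
clearbody r f; clear w0.
have sgE (t : R) : t != 0 -> (-1) ^+ (t < 0)%R = Num.sg t.
  by move=> t0; rewrite neqr0_sign.
have near_sg : \forall q \near u, Num.sg (f q) = Num.sg (f u).
  have := r0 u; rewrite -fu neq_lt => /orP[fu0|fu0].
    have h : \forall q \near u, f q < 0 by exact: cf _ (lt_nbhsl fu0).
    apply: filterS h => q fq.
    by rewrite (ltr0_sg fq) (ltr0_sg fu0).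
  have h : \forall q \near u, 0 < f q by exact: cf _ (lt_nbhsr fu0).
  apply: filterS h => q fq.
  by rewrite (gtr0_sg fq) (gtr0_sg fu0).
apply: filterS near_sg => q; rewrite fE fu sgrM => e.
by rewrite !sgE // mulrC e.
Qed.

Theorem proposition4p1 (R : realType) (n : nat) (M : manifold R n.*2.+1)
    (alpha : dform R M 1) (Rv : vfield M) (J : endo M) (eps : dform R[i]%C M n)
    (hCY : contact_CY alpha Rv J eps)
    (L : manifold R n) (p : L -> M) (hp : submanifold p) :
  ((forall u v, pullback p alpha u v = 0) /\
   (forall u v, pullback p (Im_form eps) u v = 0))
  <->
  (exists o : L -> bool,
     orientation o /\
     calibrated_by p (metric alpha J) o (Re_form eps)).
Proof.
have [reF _] := Lambda_form (cy_type hCY).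
pose std (i : 'I_n) : 'rV[R]_n := delta_mx 0 i.
pose r u := Re_form eps (p u) (fun i => tangent_map p u (std i)).
pose H u := \matrix_(i < n, j < n)
  induced_metric p (metric alpha J) u (delta_mx 0 i) (delta_mx 0 j).
have H0 u : 0 < \det (H u).
  by have [y [_ _ -> y0]] := induced_frame hCY hp u; exact: prodr_gt0.
split=> [[pa im0]|].
  have rE u : r u ^+ 2 = \det (H u).
    rewrite -(legendrian_norm_sq hCY hp u pa).
    have -> : Im_form eps (p u) (tangent_map p u \o std) = 0 by exact: (im0 u std).
    by rewrite expr0n addr0.
  have r0 u : r u != 0 by rewrite -sqrf_eq0 rE gt_eqF.
  (* [o u] marks a negatively oriented coordinate frame, so it records where [r] is negative; the
     sign times the square root of [r u ^+ 2] is then [r u]. *)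
  exists (fun u => r u < 0); split.
    exact: (frame_sign_orientation (sub_smooth hp) reF r0).
  move=> u v; have [/(_ (p u)) reA _] := reF.
  have /= top := @pullback_top R n M L p u _ v reA; rewrite /pullback top.
  by rewrite /volume_form -/(H u) -rE sqrtr_sqr -realEsign ?num_real // mulrC.
case=> o [_ cal].
have pt u : (forall v, ev1 alpha (p u) (tangent_map p u v) = 0) /\
    (forall v, Im_form eps (p u) (tangent_map p u \o v) = 0).
  apply: (calibrated_point hCY hp).
  have := cal u std; rewrite /volume_form det_delta_rows mulr1 -/(H u).
  rewrite /pullback => ->.
  (* On the coordinate frame, calibration gives plus or minus the square root of the Gram
     determinant; squaring discards the orientation. *)
  by rewrite exprMn sqrr_sign mul1r sqr_sqrtr // ltW.
split=> u v; have [a0 i0] := pt u; last exact: i0.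
rewrite -(a0 (v ord0)) /pullback /ev1; congr (alpha (p u)).
by apply/funext => i; rewrite (ord1 i).
Qed.
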